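(* As $n\to\infty$, $$g_{\mathrm{PCB}}(n,K_3)=(1+o(1))\,3n.$$
   Context: Planar Constructor-Blocker game: Constructor and Blocker alternately claim previously unclaimed edges of $K_n$, Constructor moving first. Constructor may only claim an edge if her graph (the edges she has claimed) remains planar (no fixed embedding is required; at every moment her graph must admit some crossing-free plane embedding); Blocker may claim any unclaimed edge. The game ends when Constructor cannot claim any more edges or all edges are claimed. The score is the number of triangles in Constructor's graph at the end; Constructor maximizes it, Blocker minimizes it. $g_{\mathrm{PCB}}(n,K_3)$ denotes the score under optimal play. *)

(* Defs.v *)
From HB Require Import structures.
From mathcomp Require Import all_boot all_order all_algebra.
From mathcomp Require Import all_classical all_reals all_analysis.
From mathcomp Require Import Rstruct Rstruct_topology.
Set Implicit Arguments. Unset Strict Implicit. Unset Printing Implicit Defensive.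
Import Order.TTheory GRing.Theory Num.Theory.

Local Open Scope ring_scope.

Notation RR := Rdefinitions.R.

Definition unit_int : set RR := [set t | 0 <= t <= 1].
Definition open_unit_int : set RR := [set t | 0 < t < 1].

Definition planar (n : nat) (E : {set {set 'I_n}}) : Prop :=
  exists (p : 'I_n -> RR * RR) (g : {set 'I_n} -> RR -> RR * RR),
    injective p /\
    (forall e, e \in E ->
       [/\ {within unit_int, continuous (g e)}%classic,
           (forall s t, unit_int s -> unit_int t -> g e s = g e t -> s = t),
           (exists x y, [/\ e = [set x; y], x != y, g e 0 = p x & g e 1 = p y]) &
           (forall t v, open_unit_int t -> g e t <> p v)]) /\
    (forall e f, e \in E -> f \in E -> e != f ->
       forall s t, open_unit_int s -> open_unit_int t -> g e s <> g f t).

Definition Kn_edges (n : nat) : {set {set 'I_n}} := [set e : {set 'I_n} | #|e| == 2%N].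

Definition triangles (n : nat) (E : {set {set 'I_n}}) : nat :=
  #|[set t : {set 'I_n} | (#|t| == 3%N) &&
      [forall x in t, forall y in t, (x != y) ==> ([set x; y] \in E)]]|.

(* Value of the planar Constructor-Blocker game (score = triangles of
   Constructor's graph C) from the position (C, B), with [turnC] telling
   whether Constructor moves next, and [k] a fuel bound on the number of
   remaining moves.  Constructor maximises, Blocker minimises.
   'C(n,3) is only the neutral element of min (an upper bound on all scores). *)
Fixpoint pcb_val (n : nat) (k : nat) (turnC : bool) (C B : {set {set 'I_n}}) : nat :=
  match k with
  | 0 => triangles C
  | k'.+1 =>
    if turnC then
      let M := [set e in Kn_edges n | [&& e \notin C, e \notin B & `[< planar (e |: C) >]]] in
      if #|M| == 0%N then triangles C
      else \max_(e in M) pcb_val k' false (e |: C) B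
    else
      let U := [set e in Kn_edges n | (e \notin C) && (e \notin B)] in
      if #|U| == 0%N then triangles C
      else \big[minn/'C(n, 3)]_(e in U) pcb_val k' true C (e |: B)
  end.

(* g_PCB(n, K_3): Constructor moves first from the empty position; every move
   claims a new edge, so 'C(n,2) moves of fuel suffice for the game to end. *)
Definition g_PCB_K3 (n : nat) : nat := @pcb_val n 'C(n, 2) true finset.set0 finset.set0.

(* Main.v *)
Require Import Defs.
From mathcomp Require Import all_boot zify.
(** Upper bound.  Summing over the vertices, three times the number of triangles
    of a planar graph is the number of edges inside the neighbourhoods N(v).
    The graph spanned by v and N(v) is planar, so it has at most 3(d(v) + 1) - 6
    edges and N(v) spans at most 2d(v) - 3; with at most 3n edges in total, this
    gives 3n triangles.  The edge bound is Mader's contraction argument: more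
    than 3n - 6 edges force a K_5 minor.  That arcs in the plane cannot realise a
    K_5 minor is a parity count: arcs of disjoint edges are at positive distance,
    so they can be replaced by finite chains of points, and the crossings modulo
    2 of such chains with horizontal rays satisfy contradictory equations.

    Lower bound.  Constructor fixes M hubs.  A hub a has two slots; a slot is an
    edge ab carrying two growing paths, all of whose vertices are joined to a and
    b.  A new vertex v with fewer than M blocked edges is unblocked towards some
    whole gadget.  She claims va, then vb in a slot not hit by Blocker's reply,
    then joins v to the end of one of the two paths not hit by his next reply.
    This yields three new triangles, except O(M) times overall, and Blocker's
    fewer than 3n edges can spoil at most 6n/M vertices. *)

Set Implicit Arguments. Unset Strict Implicit. Unset Printing Implicit Defensive.

(** * K_5 minors and the number of edges *)

Definition induced_rel (V : finType) (A : {set V}) (e : rel V) : rel V :=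
  [rel x y | [&& x \in A, y \in A & e x y]].

(** In place of connected branch sets with an edge between any two, walks between representatives
    inside the union of two branch sets are asked for. The parity count uses just these walks: for
    disjoint index pairs they share no vertex. *)
Definition K5_model (V : finType) (e : rel V) (S : {set V}) : Prop :=
  exists (r : 'I_5 -> V) (B : 'I_5 -> {set V}),
    [/\ forall i, B i \subset S, forall i, r i \in B i,
        forall i j, i != j -> [disjoint B i & B j] &
        forall i j, i != j -> connect (induced_rel (B i :|: B j) e) (r i) (r j)].

Definition adj (V : finType) (E : {set {set V}}) : rel V :=
  [rel x y | (x != y) && ([set x; y] \in E)].

Section Mader.
Variable V : finType.
Implicit Types (e : rel V) (S A N : {set V}) (x y v w : V).

Definition nbrs e S x := [set y in S | e x y].
(** Ordered pairs count every edge of a simple graph twice, so the bound of 3s - 6 edges on s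
    vertices reads 6s - 12 here. *)
Definition adj_pairs e S := [set z : V * V | [&& z.1 \in S, z.2 \in S & e z.1 z.2]].

Lemma card_adj_pairs e S : #|adj_pairs e S| = \sum_(x in S) #|nbrs e S x|.
Proof.
rewrite -sum1_card (eq_bigr (fun x => \sum_(y in nbrs e S x) 1)); last first.
  by move=> x _; rewrite sum1_card.
rewrite pair_big_dep /=; apply: eq_bigl => -[x y]; rewrite !inE /=.
by case: (x \in S).
Qed.

Lemma adj_pairs_rem e S v : symmetric e ->
  #|adj_pairs e S| <= #|adj_pairs e (S :\ v)| + 2 * #|nbrs e S v|.
Proof.
move=> sym.
have sub : adj_pairs e S \subset adj_pairs e (S :\ v) :|:
    ((fun y => (v, y)) @: nbrs e S v :|: (fun y => (y, v)) @: nbrs e S v).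
  apply/subsetP => -[x y]; rewrite !inE /= => /and3P[xS yS exy].
  have [xv|xv] := eqVneq x v.
    by apply/orP; right; apply/orP; left; rewrite xv imset_f // inE yS -xv.
  have [yv|yv] := eqVneq y v; last by rewrite xS yS exy.
  by apply/orP; right; apply/orP; right; rewrite yv imset_f // inE xS -yv sym.
apply: leq_trans (subset_leq_card sub) _; apply: leq_trans (leq_card_setU _ _) _.
rewrite leq_add2l mul2n -addnn; apply: leq_trans (leq_card_setU _ _) _.
by apply: leq_add; exact: leq_imset_card.
Qed.

Lemma induced_sym A e : symmetric e -> symmetric (induced_rel A e).
Proof. by move=> sym x y; rewrite /induced_rel /= sym andbCA. Qed.

(** [y] is merged into [x] but stays in the vertex type; restricting the vertex set to [S :\ y]
    discards it. *)
Definition contract e x y : rel V :=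
  [rel a b | (a != b) && [|| e a b, (a == x) && e y b | (b == x) && e a y]].

Lemma contract_sym e x y : symmetric e -> symmetric (contract e x y).
Proof.
move=> sym a b; rewrite /contract /= eq_sym (sym b a) (sym y b) (sym y a).
by congr (_ && (_ || _)); rewrite orbC.
Qed.

Lemma contract_irr e x y : irreflexive (contract e x y).
Proof. by move=> a; rewrite /contract /= eqxx. Qed.

(** Merging loses the edge [xy] and, for each common neighbour c, one of the edges xc and yc. *)
Lemma adj_pairs_contract e S x y : symmetric e -> irreflexive e ->
  x \in S -> y \in S -> e x y ->
  #|adj_pairs e S| <= #|adj_pairs (contract e x y) (S :\ y)| + 2 + 2 * #|nbrs e S x :&: nbrs e S y|.
Proof.
move=> sym irr xS yS exy.
have xy : x != y by apply: contraTneq exy => ->; rewrite irr.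
set P := adj_pairs e S; set C := _ :&: _.
(* [D] holds the lost pairs. Off [D], the map [phi] sending [y] to [x] is injective on pairs and
   lands in the contracted graph. *)
pose D := [set (x, y); (y, x)] :|: ((fun c => (y, c)) @: C :|: (fun c => (c, y)) @: C).
have cD : #|D| <= 2 + 2 * #|C|.
  apply: leq_trans (leq_card_setU _ _) _; apply: leq_add.
    by rewrite cards2; case: (_ != _).
  rewrite mul2n -addnn; apply: leq_trans (leq_card_setU _ _) _.
  by apply: leq_add; exact: leq_imset_card.
pose phi a := if a == y then x else a.
have phiE a : a != y -> phi a = a by rewrite /phi => /negPf->.
have phiy : phi y = x by rewrite /phi eqxx.
suff : #|P :\: D| <= #|adj_pairs (contract e x y) (S :\ y)|.
  have := cardsID D P; have := subset_leq_card (subsetIr P D); lia.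
have inD a b : (a, b) \in P :\: D ->
    [/\ a \in S, b \in S, e a b & [/\ (a = x -> b <> y), (a = y -> b <> x),
       (a = y -> e x b -> False) & (b = y -> e x a -> False)]].
  rewrite !inE /= => /andP[nD /and3P[aS bS eab]]; split => //.
  move: nD; rewrite !negb_or => /and3P[/andP[n1 n2] n3 n4]; split.
  - by move=> ax yb; move: n1; rewrite ax yb !eqxx.
  - by move=> ay bx; move: n2; rewrite ay bx !eqxx.
  - move=> ay exb; case/negP: n3; rewrite ay imset_f // !inE bS exb.
    by rewrite -ay eab.
  - move=> yb exa; case/negP: n4; rewrite yb imset_f // !inE aS exa.
    by rewrite -yb sym eab.
rewrite -(card_in_imset (f := fun z : V * V => (phi z.1, phi z.2))).
  apply: subset_leq_card; apply/subsetP => _ /imsetP[[a b] /inD[aS bS eab [h1 h2 h3 h4]] ->].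
  rewrite !inE /=.
  have phiS c : c \in S -> (phi c != y) && (phi c \in S).
    by rewrite /phi; case: (eqVneq c y) => // cy cS; rewrite ?xy ?cy.
  move: (phiS a aS) (phiS b bS) => /andP[-> ->] /andP[-> ->] /=.
  have [ay|ay] := eqVneq a y; have [yb|yb] := eqVneq b y.
  - by rewrite ay yb irr in eab.
  - rewrite ay phiy phiE // /contract /= eqxx -ay eab !orbT andbT.
    by apply/eqP => xb; apply: h2.
  - rewrite yb phiy phiE // /contract /= eqxx -yb eab !orbT andbT.
    by apply/eqP => xb; apply: h1.
  - by rewrite !phiE // /contract /= eab andbT; apply: contraTneq eab => ->; rewrite irr.
move=> [a b] [a' b'] /inD[aS bS eab [h1 h2 h3 h4]] /inD[aS' bS' eab' [h1' h2' h3' h4']] [].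
rewrite /phi {phi phiE phiy}; have [ay|ay] := eqVneq a y; have [ay'|ay'] := eqVneq a' y;
have [yb|yb] := eqVneq b y; have [yb'|yb'] := eqVneq b' y => pa pb; first
  [ by rewrite pa pb | by rewrite ay ay' pb | by rewrite pa yb yb' | by rewrite ay ay' yb yb'
  | by move: eab; rewrite ay yb irr | by move: eab'; rewrite ay' yb' irr
  | by move: eab'; rewrite -pa -pb irr | by move: eab; rewrite pa pb irr
  | by case: (h2 ay) | by case: (h1 pa)
  | by case: (h3 ay); rewrite pa pb | by case: (h3' ay'); rewrite -pa -pb
  | by case: (h4 yb); rewrite pa pb sym | by case: (h4' yb'); rewrite -pa -pb sym ].
Qed.

Lemma K5_model_sub e e' S S' : subrel e e' -> S \subset S' ->
  K5_model e S -> K5_model e' S'.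
Proof.
move=> ee SS [r [B [sB rB dB cB]]]; exists r, B; split => //.
  by move=> i; exact: subset_trans (sB i) SS.
move=> i j /cB; apply: connect_sub => a b /and3P[aB bB ab].
by apply: connect1; rewrite /induced_rel /= aB bB ee.
Qed.

(** [y] is added to the branch set containing [x], if there is one; a step created by the
    contraction becomes a detour through [y]. *)
Lemma K5_model_contract e S x y : symmetric e -> x \in S -> y \in S -> e x y ->
  K5_model (contract e x y) (S :\ y) -> K5_model e S.
Proof.
move=> sym xS yS exy [r [B [sB rB dB cB]]].
pose B' i := if x \in B i then y |: B i else B i.
have BB' i : B i \subset B' i by rewrite /B'; case: ifP => // _; exact: subsetUr.
have yB i : y \notin B i.
  by apply/negP => /(subsetP (sB i)); rewrite !inE eqxx.
exists r, B'; split.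
- move=> i; have Bi : B i \subset S by apply: subset_trans (sB i) (subsetDl _ _).
  by rewrite /B'; case: ifP => // _; rewrite subUset sub1set yS.
- by move=> i; apply: (subsetP (BB' i)).
- move=> i j ij; rewrite /B'; have dij := dB i j ij.
  have xij : x \in B i -> x \in B j -> False.
    by move=> xi xj; move/disjoint_setI0: dij => /setP/(_ x); rewrite !inE xi xj.
  case: ifP => xi; case: ifP => xj //.
  - by case: xij.
  - by rewrite -setI_eq0 setIUl (disjoint_setI0 dij) setU0 setI_eq0 disjoints1.
  - by rewrite -setI_eq0 setIUr (disjoint_setI0 dij) setU0 setI_eq0 disjoint_sym disjoints1.
- move=> i j ij; have := cB i j ij; apply: connect_sub => a b /and3P[aB bB].
  have sub c : c \in B i :|: B j -> c \in B' i :|: B' j.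
    by apply: subsetP; apply: setUSS.
  have xy : x \in B i :|: B j -> y \in B' i :|: B' j.
    by rewrite !inE /B' => /orP[]->; rewrite setU11 ?orbT.
  case/andP=> _ /or3P[eab|/andP[/eqP ax eyb]|/andP[/eqP bx eay]].
  + by apply: connect1; rewrite /induced_rel /= !sub.
  + subst a; apply: (connect_trans (y := y)); apply: connect1.
      by rewrite /induced_rel /= sub ?xy.
    by rewrite /induced_rel /= xy ?sub.
  + subst b; apply: (connect_trans (y := y)); apply: connect1.
      by rewrite /induced_rel /= sub ?xy // sym.
    by rewrite /induced_rel /= xy ?sub // sym.
Qed.

(* [c = a] is allowed: the second branch set is then a single vertex. *)
Lemma K5_model_intro e S v a c b d f : symmetric e ->
  all (mem S) [:: v; a; c; b; d; f] -> uniq [:: v; a; b; d; f] ->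
  c \notin [:: v; b; d; f] ->
  (c == a) || e a c -> all (e v) [:: a; b; d; f] ->
  all (fun w => e a w || e c w) [:: b; d; f] -> all (e b) [:: d; f] -> e d f ->
  K5_model e S.
Proof.
move=> sym /= /and5P[vS aS cS bS /and3P[dS fS _]].
rewrite !inE !negb_or => /and5P[/and4P[va vb vd vf] /and3P[ab ad af] /andP[bd bf] df _].
move=> /and4P[cv cb cd cf] ac /and5P[eva evb evd evf _] /and4P[eb ed ef _] /and3P[ebd ebf _] edf.
pose r (i : 'I_5) := nth v [:: v; a; b; d; f] i.
pose B (i : 'I_5) := if i == 1 :> nat then [set a; c] else [set r i].
have csym A : connect_sym (induced_rel A e).
  by apply: sym_connect_sym; exact: induced_sym.
have con w : e a w || e c w -> connect (induced_rel ([set a; c] :|: [set w]) e) a w.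
  move=> /orP[eaw|ecw]; first by apply: connect1; rewrite /induced_rel /= !inE !eqxx ?orbT.
  case/orP: ac => [/eqP ca|eac].
    by apply: connect1; rewrite /induced_rel /= !inE !eqxx ?orbT -ca.
  apply: (connect_trans (y := c)); apply: connect1; by rewrite /induced_rel /= !inE !eqxx ?orbT.
have con1 u w : e u w -> connect (induced_rel ([set u] :|: [set w]) e) u w.
  by move=> euw; apply: connect1; rewrite /induced_rel /= !inE !eqxx ?orbT.
exists r, B; split.
- move=> [[|[|[|[|[|//]]]]] lti]; by rewrite /B /r /= ?subUset !sub1set ?aS.
- by move=> [[|[|[|[|[|//]]]]] lti]; rewrite /B /r /= !inE eqxx.
{ move=> i j; wlog: i j / i < j.
    move=> H ij; have [lt|lt|/val_inj eq] := ltngtP i j; first exact: H.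
      by rewrite disjoint_sym H // eq_sym.
    by rewrite eq eqxx in ij.
  move: i j => [[|[|[|[|[|//]]]]] lti] [[|[|[|[|[|//]]]]] ltj] // _ _; rewrite /B /r /=.
  all: rewrite ?disjoints1 1?disjoint_sym ?disjoints1 !inE ?negb_or //.
  all: first [by rewrite va eq_sym
    | by rewrite (eq_sym _ a) (eq_sym _ c) ?ab ?ad ?af ?cb ?cd ?cf]. }
- move=> i j; wlog: i j / i < j.
    move=> H ij; have [lt|lt|/val_inj eq] := ltngtP i j; first exact: H.
      by rewrite csym setUC H // eq_sym.
    by rewrite eq eqxx in ij.
  move: i j => [[|[|[|[|[|//]]]]] lti] [[|[|[|[|[|//]]]]] ltj] // _ _; rewrite /B /r /=.
  all: try exact: con.
  all: try exact: con1.
  all: by rewrite csym setUC; apply: con; rewrite sym eva.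
Qed.

(** Inside the neighbourhood [N] of [v] all degrees are at least 3, while [N] has at most 5
    vertices. If [N] is complete, four of its vertices and [v] form K_5. Otherwise two vertices of
    [N] are not adjacent, and contracting one edge inside [N] produces K_5. *)
Lemma K5_model_nbrs e S v : symmetric e -> irreflexive e ->
  v \in S -> 0 < #|nbrs e S v| <= 5 ->
  (forall x y, x \in S -> y \in S -> e x y -> 2 < #|nbrs e S x :&: nbrs e S y|) ->
  K5_model e S.
Proof.
move=> sym irr vS /andP[N0 N5] common; set N := nbrs e S v in N0 N5.
have inN w : w \in N -> [/\ w \in S, e v w & v != w].
  by rewrite inE => /andP[wS vw]; split => //; apply: contraTneq vw => <-; rewrite irr.
have deg w : w \in N -> 2 < #|nbrs e N w|.
  move=> wN; have [wS vw _] := inN w wN.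
  apply: leq_trans (common v w vS wS vw) _; apply: subset_leq_card.
  by apply/subsetP => u; rewrite !inE => /andP[/andP[-> ->] /andP[_ ->]].
have NI w : w \in S -> e v w -> w \in N by move=> wS vw; rewrite inE wS.
clearbody N.
have N4 : 3 < #|N|.
  have /card_gt0P[w wN] := N0; apply: leq_trans (_ : #|w |: nbrs e N w| <= _).
    by rewrite cardsU1 !inE irr andbF ltnS deg.
  apply: subset_leq_card; rewrite subUset sub1set wN.
  by apply/subsetP => u; rewrite inE => /andP[].
(* Each vertex of [N] misses at most one other vertex of [N]. *)
have two w w1 w2 : w \in N -> w1 \in N -> w2 \in N -> w != w1 -> w != w2 -> w1 != w2 ->
    e w w1 || e w w2.
  move=> wN w1N w2N ww1 ww2 w12; apply/negP => /negP; rewrite negb_or => /andP[n1 n2].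
  have : nbrs e N w \subset N :\ w :\ w1 :\ w2.
    apply/subsetP => u; rewrite !inE => /andP[-> wu]; rewrite andbT.
    by apply/and3P; split; apply: contraTneq wu => ->; rewrite ?irr.
  move/subset_leq_card; have := deg w wN.
  have := cardsD1 w N; have := cardsD1 w1 (N :\ w); have := cardsD1 w2 (N :\ w :\ w1).
  rewrite !inE wN w1N w2N (eq_sym w1) ww1 !(eq_sym w2) ww2 w12 /=; lia.
have nonadj a b : a \in N -> b \in N -> a != b -> ~~ e a b -> K5_model e S.
  move=> aN bN ab nab.
  have sub w : w \in N :\ a :\ b -> e a w /\ e b w.
    rewrite !inE => /and3P[wb wa wN].
        have aw : a != w by rewrite eq_sym.
    have bw : b != w by rewrite eq_sym.
    have := two a b w aN bN wN ab aw bw; rewrite (negPf nab) /= => ->.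
    by have := two b a w bN aN wN; rewrite eq_sym ab aw bw sym (negPf nab) /= => ->.
  have := deg a aN.
  have : nbrs e N a \subset N :\ a :\ b.
    apply/subsetP => u; rewrite !inE => /andP[-> au]; rewrite andbT.
    by apply/andP; split; apply: contraTneq au => ->; rewrite ?irr.
  move/subset_leq_card.
  have M3 : #|N :\ a :\ b| <= 3.
    by have := cardsD1 a N; have := cardsD1 b (N :\ a); rewrite !inE aN bN eq_sym ab /=; lia.
  move=> M3' M3''; have {M3' M3''} M3'' := leq_trans M3'' M3'.
  have := cardE (mem (N :\ a :\ b)).
  have := enum_uniq (mem (N :\ a :\ b)).
  have memM w : w \in enum (N :\ a :\ b) -> w \in N :\ a :\ b by rewrite mem_enum.
  case: (enum _) memM M3 M3'' => [|c [|d [|f [|? ?]]]] memM + + + cM; rewrite cM //=.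
  move=> _ _; rewrite !inE !negb_or andbT => /andP[/andP[cd cf] df].
  have H w : w \in [:: c; d; f] ->
    [/\ w \in N, w \in S, e v w, v != w & [/\ w != a, w != b, e a w & e b w]].
    move=> /memM wM; have [aw bw] := sub w wM; move: wM; rewrite !inE => /and3P[wb wa wN].
        by have [] := inN w wN.
  have [cN cS vc vc' [ca cb ac bc]] := H c (mem_head _ _).
  have [|dN dS vd vd' [da db ad bd]] := H d; first by rewrite !inE eqxx orbT.
  have [|fN fS vf vf' [fa fb af bf]] := H f; first by rewrite !inE eqxx !orbT.
  have [aS va va'] := inN a aN; have [bS vb vb'] := inN b bN.
  (* Here [N] consists of [a], [b] and their common neighbours [c], [d], [f]. If [d] and [f] are
     adjacent, contracting [ac] suffices. *)
  have [edf|ndf] := boolP (e d f).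
    apply: (@K5_model_intro e S v a c b d f) => //=; rewrite ?inE ?negb_or.
    - by rewrite vS aS cS bS dS fS.
    - by rewrite va' vb' vd' vf' ab !(eq_sym a) !(eq_sym b) da fa db fb df.
    - by rewrite eq_sym vc' cb cd cf.
    - by rewrite ac orbT.
    - by rewrite va vb vd vf.
    - by rewrite (sym c) bc ad af orbT.
    - by rewrite bd bf.
  (* Since [d] and [f] miss each other, both are adjacent to [c]; now [ad] is contracted. *)
  have := two d c f dN cN fN; rewrite eq_sym cd df cf (negPf ndf) orbF => /(_ isT isT isT) dc.
  have := two f c d fN cN dN; rewrite eq_sym cf eq_sym df cd sym (sym f) (negPf ndf) orbF.
  move=> /(_ isT isT isT) fc.
  apply: (@K5_model_intro e S v a d b c f) => //=; rewrite ?inE ?negb_or.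
  - by rewrite vS aS cS bS dS fS.
  - by rewrite va' vb' vc' vf' ab !(eq_sym a) !(eq_sym b) ca fa cb fb cf.
  - by rewrite eq_sym vd' db eq_sym cd df.
  - by rewrite ad orbT.
  - by rewrite va vb vc vf.
  - by rewrite (sym d) bd ac af orbT.
  - by rewrite bc bf.
have : exists a b c d, uniq [:: a; b; c; d] /\ {subset [:: a; b; c; d] <= N}.
  have := cardE (mem N); have := enum_uniq (mem N).
  have memM w : w \in enum N -> w \in N by rewrite mem_enum.
  case: (enum _) memM => [|a [|b [|c [|d s]]]] memM U cN; rewrite cN // in N4.
  exists a, b, c, d; split.
    by move: U; rewrite -[_ :: _]/([:: a; b; c; d] ++ s) cat_uniq => /andP[].
  by move=> w ws; apply: memM; rewrite -[_ :: _]/([:: a; b; c; d] ++ s) mem_cat ws.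
move=> [a [b [c [d []]]]]; rewrite /= !inE !negb_or.
move=> /and4P[/and3P[ab ac ad] /andP[bc bd] cd _] sN.
have aN : a \in N by apply: sN; rewrite !inE eqxx.
have bN : b \in N by apply: sN; rewrite !inE eqxx !orbT.
have cN : c \in N by apply: sN; rewrite !inE eqxx !orbT.
have dN : d \in N by apply: sN; rewrite !inE eqxx !orbT.
have [eab|] := boolP (e a b); last exact: nonadj.
have [eac|] := boolP (e a c); last exact: nonadj.
have [ead|] := boolP (e a d); last exact: nonadj.
have [ebc|] := boolP (e b c); last exact: nonadj.
have [ebd|] := boolP (e b d); last exact: nonadj.
have [ecd|] := boolP (e c d); last exact: nonadj.
have [aS va va'] := inN a aN; have [bS vb vb'] := inN b bN.
have [cS vc vc'] := inN c cN; have [dS vd vd'] := inN d dN.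
apply: (@K5_model_intro e S v a a b c d) => //=; rewrite ?inE ?negb_or.
- by rewrite vS aS bS cS dS.
- by rewrite va' vb' vc' vd' ab ac ad bc bd cd.
- by rewrite eq_sym va' ab ac ad.
- by rewrite eqxx.
- by rewrite va vb vc vd.
- by rewrite eab eac ead.
- by rewrite ebc ebd.
Qed.
Lemma card_nbrs_lt e S x : irreflexive e -> x \in S -> #|nbrs e S x| < #|S|.
Proof.
move=> irr xS; rewrite (cardsD1 x S) xS ltnS; apply: subset_leq_card.
apply/subsetP => u; rewrite !inE => /andP[-> xu]; rewrite andbT.
by apply: contraTneq xu => ->; rewrite irr.
Qed.

Lemma card_adj_pairs_le e S : irreflexive e -> #|adj_pairs e S| <= #|S| * #|S|.-1.
Proof.
move=> irr; rewrite card_adj_pairs -sum_nat_const; apply: leq_sum => x xS.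
by have := card_nbrs_lt irr xS; lia.
Qed.

(** Induction on the number of vertices, then on the number of pairs. Deleting a vertex of degree at
    most 3, or contracting an edge with at most 2 common neighbours, costs at most 6 pairs, and the
    bound drops by 6 as well. If neither is possible and the average degree is below 6, some vertex
    of degree at most 5 satisfies [K5_model_nbrs]. *)
Theorem mader_K5 e S : symmetric e -> irreflexive e -> 2 < #|S| ->
  6 * #|S| < #|adj_pairs e S| + 12 -> K5_model e S.
Proof.
move: {2}#|S| (leqnn #|S|) => s; elim: s e S => [|s IHs] e S; first by lia.
move: {2}#|adj_pairs e S| (leqnn #|adj_pairs e S|) => m.
elim: m e => [|m IHm] e lem les sym irr S3 big; first by lia.
have S4 : 3 < #|S|.
  have := card_adj_pairs_le S irr; move: S3 big; case: #|S| => [|[|[|[|k]]]] //= _ ? ?; lia.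
have [/existsP[v /andP[vS dv]]|nlow] := boolP [exists v, (v \in S) && (#|nbrs e S v| <= 3)].
  have := adj_pairs_rem S v sym; have := cardsD1 v S; rewrite vS => cS pS.
  apply: (@K5_model_sub e e (S :\ v)) => //; first exact: subsetDl.
  by apply: IHs => //; lia.
have [/existsP[x /existsP[y /and4P[xS yS exy cxy]]]|ncon] := boolP [exists x, exists y,
    [&& x \in S, y \in S, e x y & #|nbrs e S x :&: nbrs e S y| <= 2]].
  have := adj_pairs_contract sym irr xS yS exy; have := cardsD1 y S; rewrite yS => cS pS.
  apply: (K5_model_contract sym xS yS exy).
  apply: IHs; [lia| exact: contract_sym| exact: contract_irr| lia | lia].
have common x y : x \in S -> y \in S -> e x y -> 2 < #|nbrs e S x :&: nbrs e S y|.
  move=> xS yS exy; move: ncon; rewrite negb_exists => /forallP/(_ x).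
  by rewrite negb_exists => /forallP/(_ y); rewrite xS yS exy /= ltnNge.
(* With at least 6s pairs, an edge can be deleted (two pairs) and the count still exceeds 6s - 12;
   with fewer, some degree is at most 5. *)
have [small|large] := leqP #|adj_pairs e S| (6 * #|S|).-1.
  have [/existsP[v /andP[vS dv]]|] := boolP [exists v, (v \in S) && (#|nbrs e S v| <= 5)].
    apply: (K5_model_nbrs sym irr vS) common; rewrite dv andbT.
    move: nlow; rewrite negb_exists => /forallP/(_ v); rewrite vS /=; lia.
  rewrite negb_exists => /forallP H.
  have : \sum_(x in S) 6 <= \sum_(x in S) #|nbrs e S x|.
    by apply: leq_sum => x xS; have := H x; rewrite xS /=; lia.
  rewrite sum_nat_const -card_adj_pairs; lia.
have /card_gt0P[[x y]] : 0 < #|adj_pairs e S| by lia.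
rewrite inE /= => /and3P[xS yS exy].
pose e' : rel V := [rel a b | e a b && ((a, b) \notin [:: (x, y); (y, x)])].
have subP : adj_pairs e' S \subset adj_pairs e S :\ (x, y).
  apply/subsetP => -[a b]; rewrite !inE /e' /= !inE negb_or.
  by move=> /and4P[-> -> -> /andP[-> _]].
have supP : adj_pairs e S \subset (x, y) |: ((y, x) |: adj_pairs e' S).
  apply/subsetP => -[a b]; rewrite !inE /e' /= => /and3P[-> -> ->] /=.
  by rewrite orbA -in_set2 !inE orbN.
have := subset_leq_card supP; rewrite !cardsU1.
have := subset_leq_card subP; have := cardsD1 (x, y) (adj_pairs e S).
rewrite inE /= xS yS exy /= add1n => c1 c2 c3.
have c4 : #|adj_pairs e S| <= 2 + #|adj_pairs e' S|.
  by apply: leq_trans c3 _; rewrite addnA leq_add2r; do 2 case: (_ \notin _).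
apply: (@K5_model_sub e' e S) => //; first by move=> a b /andP[].
apply: IHm => //.
- by apply: leq_trans c2 _; rewrite -ltnS -c1.
- by move=> a b; rewrite /e' /= sym !inE !xpair_eqE orbC (andbC (a == _)) (andbC (a == _)).
- by move=> a; rewrite /e' /= irr.
- by lia.
Qed.
End Mader.

(** * Triangles in graphs without a K_5 minor *)

Section Triangles.
Variable V : finType.
Implicit Types (e : rel V) (S A N : {set V}) (x y v w : V).

(** Ordered triangles: each triangle inside [S] occurs six times. *)
Definition adj_triples e S :=
  [set t : V * (V * V) | (t.1 \in S) && (t.2 \in adj_pairs e (nbrs e S t.1))].

Lemma card_adj_triples e S :
  #|adj_triples e S| = \sum_(v in S) #|adj_pairs e (nbrs e S v)|.
Proof.
rewrite -sum1_card (eq_bigr (fun x => \sum_(z in adj_pairs e (nbrs e S x)) 1)); last first.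
  by move=> x _; rewrite sum1_card.
by rewrite pair_big_dep /=; apply: eq_bigl => -[x y]; rewrite inE.
Qed.

(** On [v] and its d neighbours there are at most 6(d + 1) - 12 ordered pairs by [mader_K5], and 2d
    of them contain [v]. *)
Lemma link_bound e S v : symmetric e -> irreflexive e -> ~ K5_model e setT ->
  1 < #|nbrs e S v| -> #|adj_pairs e (nbrs e S v)| + 6 <= 4 * #|nbrs e S v|.
Proof.
move=> sym irr noK5 d2; set N := nbrs e S v in d2 *.
have vN : v \notin N by rewrite inE irr andbF.
have cA : #|v |: N| = #|N|.+1 by rewrite cardsU1 vN.
have [] := leqP #|adj_pairs e (v |: N)| (6 * #|N| - 6); last first.
  move=> big; case: noK5; apply: (@K5_model_sub _ e e (v |: N)) => //.
  by apply: mader_K5 => //; rewrite cA; lia.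
rewrite !card_adj_pairs big_setU1 //=.
have -> : nbrs e (v |: N) v = N.
  apply/setP => u; rewrite in_set in_setU1; have [->|_] := eqVneq u v.
    by rewrite irr (negPf vN).
  by rewrite /N inE; case: (e v u); rewrite ?andbF ?andbT.
have : \sum_(x in N) (#|nbrs e N x| + 1) <= \sum_(x in N) #|nbrs e (v |: N) x|.
  apply: leq_sum => x; rewrite inE => /andP[xS vx].
  apply: leq_trans (_ : #|v |: nbrs e N x| <= _).
    by rewrite cardsU1 inE (negPf vN) addn1.
  apply: subset_leq_card; rewrite subUset sub1set !inE eqxx sym vx /=.
  by apply/subsetP => u; rewrite !inE => /andP[/andP[-> ->] ->]; rewrite orbT.
rewrite big_split /= sum1_card; lia.
Qed.

(** Vertices of degree at most 1 lie in no triangle and are removed first. For the others the link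
    bounds 4d - 6 add up to at most 4 times 6s minus 6s, which is 18s. *)
Lemma adj_triples_bound e S : symmetric e -> irreflexive e -> ~ K5_model e setT ->
  #|adj_triples e S| <= 18 * #|S|.
Proof.
move=> sym irr noK5.
move: {2}#|S| (leqnn #|S|) => m; elim: m S => [|m IH] S cS.
  have -> : S = set0 by apply/eqP; rewrite -cards_eq0; lia.
  by rewrite card_adj_triples big_set0.
have [/existsP[v /andP[vS dv]]|nlow] := boolP [exists v, (v \in S) && (#|nbrs e S v| <= 1)].
  have := cardsD1 v S; rewrite vS => cSv.
  apply: leq_trans (_ : #|adj_triples e (S :\ v)| <= _); last by have := IH (S :\ v); lia.
  apply: subset_leq_card; apply/subsetP => -[a [b c]]; rewrite !inE /=.
  move=> /andP[aS /and3P[/andP[bS ab] /andP[cS' ac] bc]].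
  have two x y z : x \in S -> y \in S -> z \in S -> e x y -> e x z -> e y z -> x != v.
    move=> xS yS zS xy xz yz; apply: contraTneq dv => <-; rewrite -ltnNge.
    have yz' : y != z by apply: contraTneq yz => ->; rewrite irr.
    apply: leq_trans (_ : #|[set y; z]| <= _); first by rewrite cards2 yz'.
    by apply: subset_leq_card; rewrite subUset !sub1set !inE yS zS xy xz.
  have av := two a b c aS bS cS' ab ac bc.
  have bv : b != v by apply: (two b a c) => //; rewrite sym.
  have cv : c != v by apply: (two c a b) => //; rewrite sym.
  by rewrite aS bS cS' ab ac bc av bv cv.
rewrite card_adj_triples.
have pairs : #|adj_pairs e S| <= 6 * #|S|.
  have [S2|S3] := leqP #|S| 2.
    have := card_adj_pairs_le S irr; case: #|S| S2 => [|[|[|]]] //=; lia.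
  rewrite leqNgt; apply/negP => big; case: noK5.
  apply: (@K5_model_sub _ e e S) => //; apply: mader_K5 => //; lia.
have : \sum_(v in S) (#|adj_pairs e (nbrs e S v)| + 6) <= \sum_(v in S) 4 * #|nbrs e S v|.
  apply: leq_sum => v vS; apply: link_bound => //.
  by move: nlow; rewrite negb_exists => /forallP/(_ v); rewrite vS -ltnNge.
rewrite big_split /= sum_nat_const -big_distrr /= -card_adj_pairs; lia.
Qed.

Lemma cards3 (t : {set V}) : #|t| = 3 -> exists a b c, uniq [:: a; b; c] /\ t = [set a; b; c].
Proof.
move=> t3; have := cardE t; have := enum_uniq t.
have memt w : (w \in t) = (w \in enum t) by rewrite mem_enum.
case: (enum t) memt => [|a [|b [|c [|? ?]]]] memt U; rewrite t3 // => _.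
exists a, b, c; split => //; apply/setP => w.
by rewrite memt !inE orbA.
Qed.

Lemma adj_sym (E : {set {set V}}) : symmetric (adj E).
Proof. by move=> x y; rewrite /adj /= eq_sym setUC. Qed.

Lemma adj_irr (E : {set {set V}}) : irreflexive (adj E).
Proof. by move=> x; rewrite /adj /= eqxx. Qed.


Definition is_triangle (E : {set {set V}}) (t : {set V}) :=
  (#|t| == 3) && [forall x in t, forall y in t, (x != y) ==> ([set x; y] \in E)].

Lemma card_triangles_le (E : {set {set V}}) :
  6 * #|[set t | is_triangle E t]| <= #|adj_triples (adj E) setT|.
Proof.
set T := [set t | _]; set Z := adj_triples _ _.
pose f (z : V * (V * V)) := [set z.1; z.2.1; z.2.2].
rewrite mulnC -sum_nat_const -[X in _ <= X]sum1_card.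
have fT z : z \in Z -> f z \in T.
  case: z => a [b c]; rewrite !inE /f /= => /andP[/andP[ab abE] /andP[/andP[ac acE] /andP[bc bcE]]].
  rewrite /is_triangle; apply/andP; split.
    by rewrite -setUA cardsU1 cards2 !inE negb_or ab ac bc.
  apply/forall_inP => x xt; apply/forall_inP => y yt; apply/implyP.
  move: xt yt; rewrite !inE => /orP[/orP[]|] /eqP-> /orP[/orP[]|] /eqP->; by rewrite ?eqxx // setUC.
rewrite (partition_big f (mem T)) //=; apply: leq_sum => t tT.
have := tT; rewrite inE => /andP[/eqP t3 /forall_inP tE].
have [a [b [c [U tabc]]]] := cards3 t3.
have H x y : x \in t -> y \in t -> x != y -> adj E x y.
  by move=> xt yt xy; rewrite /adj /= xy; have /forall_inP/(_ y yt) := tE x xt; rewrite xy.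
move: U; rewrite /= !inE negb_or andbT => /andP[/andP[ab ac] bc].
have [at_ bt ct] : [/\ a \in t, b \in t & c \in t] by split; rewrite tabc !inE eqxx ?orbT.
pose s := [:: (a, (b, c)); (a, (c, b)); (b, (a, c)); (b, (c, a)); (c, (a, b)); (c, (b, a))].
have Us : uniq s.
  by rewrite /s /= !inE !xpair_eqE !negb_or !negb_and !(eq_sym c) !(eq_sym b a) ab ac bc !orbT.
rewrite sum1_card -[6]/(size s) -(card_uniqP Us).
apply: subset_leq_card; apply/subsetP => z zs; rewrite unfold_in /=.
suff : exists x y w, [/\ z = (x, (y, w)), t = [set x; y; w],
    [&& x \in t, y \in t & w \in t] & [/\ x != y, x != w & y != w]].
  move=> [x [y [w [-> txyw /and3P[xt yt wt] [xy xw yw]]]]].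
  by rewrite /f -txyw eqxx andbT inE /= !inE !H.
have t1 : t = [set a; c; b] by rewrite tabc setUAC.
have t2 : t = [set b; a; c] by rewrite tabc (setUC [set a]).
have t3' : t = [set b; c; a] by rewrite t2 setUAC.
have t4 : t = [set c; a; b] by rewrite t1 (setUC [set a]).
have t5 : t = [set c; b; a] by rewrite t4 setUAC.
move: zs; rewrite !inE => /or4P[/eqP->|/eqP->|/eqP->|/or3P[] /eqP->].
- by exists a, b, c; rewrite at_ bt ct.
- by exists a, c, b; rewrite at_ bt ct; do !split; rewrite // eq_sym.
- by exists b, a, c; rewrite at_ bt ct; do !split; rewrite // eq_sym.
- by exists b, c, a; rewrite at_ bt ct; do !split; rewrite // eq_sym.
- by exists c, a, b; rewrite at_ bt ct; do !split; rewrite // eq_sym.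
- by exists c, b, a; rewrite at_ bt ct; do !split; rewrite // eq_sym.
Qed.

Lemma card_triangles_bound (E : {set {set V}}) : ~ K5_model (adj E) setT ->
  #|[set t | is_triangle E t]| <= 3 * #|V|.
Proof.
move=> noK5; rewrite -(leq_pmul2l (m := 6)) // mulnA.
apply: leq_trans (card_triangles_le E) _; rewrite -cardsT.
exact: adj_triples_bound (@adj_sym E) (@adj_irr E) noK5.
Qed.

End Triangles.

From mathcomp Require Import all_order all_algebra lra.
From Stdlib Require Import Ring.
Import Order.TTheory GRing.Theory Num.Theory.

(** * Crossing parity of polygonal drawings of K_5 *)

Section CrossingParity.
Local Open Scope ring_scope.
Variables (R : realFieldType) (eps : R).
Implicit Types (u v p q x y : R * R) (s t : seq (R * R)).

(* With steps shorter than [eps] and distances at least [3 * eps], two steps are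
   separated by a horizontal or a vertical line, so crossings need no geometry. *)
Definition near_pt u v := (`|u.1 - v.1| < eps) && (`|u.2 - v.2| < eps).
Definition far_pt u v := (3 * eps <= `|u.1 - v.1|) || (3 * eps <= `|u.2 - v.2|).

(* [rcross q u v]: the rightward ray from [q] crosses the step [uv];
   [lcross u q q']: the leftward ray from [u] crosses the step [qq'].
   The half-open conventions amount to moving [q] and [q'] up infinitesimally,
   and [lexlt] compares heights after an infinitesimal shear. *)
Definition rcross q u v := (q.1 < u.1) && ((u.2 <= q.2) != (v.2 <= q.2)).
Definition lcross u q q' := (q.1 < u.1) && ((u.2 <= q.2) != (u.2 <= q'.2)).
Definition lexlt q p := (q.2 < p.2) || ((q.2 == p.2) && (p.1 < q.1)).

Lemma lexltN p q : p != q -> lexlt q p = ~~ lexlt p q.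
Proof.
rewrite /lexlt; case: p q => [a b] [c d] /=; rewrite xpair_eqE /=.
by case: (ltgtP b d); case: (ltgtP a c).
Qed.

Lemma near_ptC u v : near_pt u v = near_pt v u.
Proof. by rewrite /near_pt distrC (distrC u.2). Qed.

Lemma near_far u v q q' : near_pt u v -> near_pt q q' -> far_pt u q ->
  [\/ [/\ q.2 < u.2, q.2 < v.2, q'.2 < u.2 & q'.2 < v.2],
      [/\ u.2 < q.2, v.2 < q.2, u.2 < q'.2 & v.2 < q'.2],
      [/\ q.1 < u.1, q.1 < v.1, q'.1 < u.1 & q'.1 < v.1] |
      [/\ u.1 < q.1, v.1 < q.1, u.1 < q'.1 & v.1 < q'.1]].
Proof.
rewrite /near_pt /far_pt !ltr_norml !ler_normr.
move=> /andP[/andP[A1 A2] /andP[A3 A4]] /andP[/andP[B1 B2] /andP[B3 B4]].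
move=> /orP[] /orP[] H.
- by apply: Or43; split; lra.
- by apply: Or44; split; lra.
- by apply: Or41; split; lra.
- by apply: Or42; split; lra.
Qed.

(** If a horizontal line separates the steps, or [uv] lies to the left, nothing crosses. If [qq']
    lies to the left, both sides add the same four height comparisons. *)
Lemma cross_step u v q q' : near_pt u v -> near_pt q q' -> far_pt u q ->
  rcross q u v (+) rcross q' u v = lcross u q q' (+) lcross v q q'.
Proof.
move=> uv qq uq; rewrite /rcross /lcross.
case: (near_far uv qq uq) => -[H1 H2 H3 H4].
- by rewrite !(leNgt _.2) H1 H2 H3 H4 /= !andbF.
- by rewrite !(ltW H1, ltW H2, ltW H3, ltW H4) /= !andbF.
- by rewrite H1 H2 H3 /=; do !case: (_ <= _).
- by rewrite !ltNge !(ltW H1, ltW H2, ltW H3, ltW H4).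
Qed.

(** The step crosses the horizontal line through [p], on the right or on the left, precisely when
    its ends lie on different sides in the order [lexlt]. *)
Lemma height_step p q q' : near_pt q q' -> far_pt p q ->
  rcross p q q' (+) lcross p q q' = lexlt q p (+) lexlt q' p.
Proof.
move=> qq pq; have [e0|e0] := leP eps 0.
  by move: qq => /andP[/(le_lt_trans (normr_ge0 _))]; rewrite ltNge e0.
have pp : near_pt p p by rewrite /near_pt !subrr normr0 e0.
rewrite /rcross /lcross /lexlt.
case: (near_far pp qq pq) => -[H1 _ H2 _].
- by rewrite !(leNgt p.2) H1 H2 (ltW H1) (ltW H2) /= !andbF.
- rewrite !(leNgt _ p.2) H1 H2 (ltW H1) (ltW H2) !ltNge (ltW H1) (ltW H2).
  by rewrite !(gt_eqF H1) !(gt_eqF H2) !andbF.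
- rewrite H1 (lt_gtF H1) (lt_gtF H2) /=.
  by case: (ltgtP q.2 p.2); case: (ltgtP q'.2 p.2).
- rewrite H1 H2 (lt_gtF H1) /=.
  by case: (ltgtP q.2 p.2); case: (ltgtP q'.2 p.2).
Qed.

Fixpoint Rcross q x s :=
  if s is y :: s' then rcross q x y (+) Rcross q y s' else false.
Fixpoint Lcross p x s :=
  if s is y :: s' then lcross p x y (+) Lcross p y s' else false.

Lemma Rcross_step q q' x s : near_pt q q' -> path near_pt x s ->
  {in x :: s, forall u, far_pt u q} ->
  Rcross q x s (+) Rcross q' x s = lcross x q q' (+) lcross (last x s) q q'.
Proof.
move=> qq; elim: s x => [|y s IH] x /=; first by rewrite addbb.
move=> /andP[xy ys] far.
rewrite addbACA cross_step ?IH //.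
- by rewrite addbA -(addbA (lcross x _ _)) addbb addbF.
- by move=> u us; apply: far; rewrite inE us orbT.
- by apply: far; rewrite mem_head.
Qed.

(** Summing [cross_step] over all pairs of steps telescopes, so only rays from the four ends
    remain. *)
Lemma Rcross_path x s y t : path near_pt x s -> path near_pt y t ->
  {in x :: s & y :: t, forall u v, far_pt u v} ->
  Rcross y x s (+) Rcross (last y t) x s = Lcross x y t (+) Lcross (last x s) y t.
Proof.
move=> xs; elim: t y => [|z t IH] y /=; first by rewrite addbb.
move=> /andP[yz zt] far.
rewrite addbACA -(Rcross_step yz) //; last first.
  by move=> u us; apply: far; rewrite ?mem_head.
rewrite -IH //; last by move=> u v us vt; apply: far; rewrite // inE vt orbT.
by rewrite addbA -(addbA (Rcross y _ _)) addbb addbF.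
Qed.

Lemma RLcross_path p x s : path near_pt x s -> {in x :: s, forall u, far_pt p u} ->
  Rcross p x s (+) Lcross p x s = lexlt x p (+) lexlt (last x s) p.
Proof.
elim: s x => [|y s IH] x /=; first by rewrite addbb.
move=> /andP[xy ys] far.
rewrite addbACA height_step ?IH //.
- by rewrite addbA -(addbA (lexlt x p)) addbb addbF.
- by move=> u us; apply: far; rewrite inE us orbT.
- by apply: far; rewrite mem_head.
Qed.


(** With [r k i j] the crossing parity of the rightward ray from vertex k with chain ij, two
    disjoint edges give a linear equation modulo 2 between values of [r] and comparisons [L] of
    heights. The three matchings of four vertices give total 1, and the sum over the five quadruples
    reads 0 = 1. *)
Lemma no_far_K5 (p : 'I_5 -> R * R) (W : 'I_5 -> 'I_5 -> seq (R * R)) :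
  injective p ->
  (forall i j, i != j -> path near_pt (p i) (W i j) /\ last (p i) (W i j) = p j) ->
  (forall i j k l, uniq [:: i; j; k; l] ->
    {in p i :: W i j & p k :: W k l, forall u v, far_pt u v}) -> False.
Proof.
move=> pinj pW farW.
pose r k i j := Rcross (p k) (p i) (W i j).
pose L i j := lexlt (p i) (p j).
have LN i j : i != j -> L i j = ~~ L j i by move=> ij; rewrite /L lexltN ?(inj_eq pinj) // eq_sym.
have pair i j k l m : uniq [:: i; j; k; l; m] ->
  r k i j (+) r l i j (+) (r i k l (+) r j k l) =
  L k i (+) L l i (+) (L k j (+) L l j).
  move=> U.
  have /and5P[i1 i2 i3 i4 _] := U.
  rewrite /= !inE !negb_or in i1 i2 i3 i4.
  case/and4P: i1 => ij ik il im; case/and3P: i2 => jk jl jm; case/andP: i3 => kl km.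
  have [pij lij] := pW i j ij; have [pkl lkl] := pW k l kl.
  have far1 := farW i j k l.
  have := @Rcross_path (p i) (W i j) (p k) (W k l) pij pkl.
  rewrite lij lkl => ->; last first.
    by apply: far1; rewrite /= !inE !negb_or ij ik il jk jl kl.
  have -> : r i k l = Lcross (p i) (p k) (W k l) (+) (L k i (+) L l i).
    have := @RLcross_path (p i) _ _ pkl; rewrite lkl => <-; last first.
      (* [p i] is far from the chain kl because it starts the chain from i to the fifth vertex m,
         which is disjoint from kl. *)
      move=> u us; apply: (farW i m k l) => //; last exact: mem_head.
      by rewrite /= !inE !negb_or im ik il (eq_sym m) km (eq_sym m) i4 kl.
    by rewrite addbC -addbA addbb addbF.
  have -> : r j k l = Lcross (p j) (p k) (W k l) (+) (L k j (+) L l j).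
    have := @RLcross_path (p j) _ _ pkl; rewrite lkl => <-; last first.
      move=> u us; apply: (farW j m k l) => //; last exact: mem_head.
      by rewrite /= !inE !negb_or jm jk jl (eq_sym m) km (eq_sym m) i4 kl.
    by rewrite addbC -addbA addbb addbF.
  by case: (Lcross (p i) _ _) (Lcross (p j) _ _) (L k i) (L l i) (L k j) (L l j)
    => [] [] [] [] [] [].
(* Over the three matchings each pair of heights is compared once in each direction, except the
   pairs with [i], whose comparisons cancel; the three remaining pairs contribute 1 each. *)
have quad i j k l m : uniq [:: i; j; k; l; m] ->
  r k i j (+) r l i j (+) (r i k l (+) r j k l)
  (+) (r j i k (+) r l i k (+) (r i j l (+) r k j l))
  (+) (r j i l (+) r k i l (+) (r i j k (+) r l j k)) = true.
  move=> U; have U1 : uniq [:: i; k; j; l; m].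
    by rewrite (perm_uniq (s2 := [:: i; j; k; l; m])) // perm_cons (perm_catCA [:: k] [:: j]).
  have U2 : uniq [:: i; l; j; k; m].
    by rewrite (perm_uniq (s2 := [:: i; j; k; l; m])) // perm_cons (perm_catCA [:: l] [:: j; k]).
  rewrite (pair _ _ _ _ _ U) (pair _ _ _ _ _ U1) (pair _ _ _ _ _ U2).
  move: U; rewrite /= !inE !negb_or => /and5P[_ /and3P[jk jl _] /andP[kl _] _ _].
  rewrite (LN j k) // (LN j l) // (LN k l) //.
  by case: (L k i) (L l i) (L j i) (L k j) (L l j) (L l k) => [] [] [] [] [] [].
pose o (n : nat) : 'I_5 := inord n.
have U a b c d e :
    [&& (a < 5)%N, (b < 5)%N, (c < 5)%N, (d < 5)%N, (e < 5)%N & uniq [:: a; b; c; d; e]] ->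
  uniq [:: o a; o b; o c; o d; o e].
  case/and5P=> a5 b5 c5 d5 /andP[e5 U].
  rewrite -(map_inj_uniq val_inj) /= !inordK //.
(* In terms of [xorb], the boolean [ring] cancels repeated terms modulo 2. *)
have addbE (x y : bool) : x (+) y = xorb x y by case: x; case: y.
(* Every [r k i j] occurs in exactly two of the five sums. *)
have := congr2 addb (congr2 addb (congr2 addb (congr2 addb
  (quad _ _ _ _ _ (U 0 1 2 3 4 isT)) (quad _ _ _ _ _ (U 0 1 2 4 3 isT)))
  (quad _ _ _ _ _ (U 0 1 3 4 2 isT))) (quad _ _ _ _ _ (U 0 2 3 4 1 isT)))
  (quad _ _ _ _ _ (U 1 2 3 4 0 isT)).
rewrite !addbE /= => sum1.
by have : false = true by rewrite -sum1; ring.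
Qed.

End CrossingParity.

From mathcomp Require Import ring.
From mathcomp Require Import all_classical all_reals all_analysis.
From mathcomp Require Import Rstruct Rstruct_topology.
Import numFieldNormedType.Exports.

(** * Planar graphs have no K_5 minor *)

Section Sampling.
Local Open Scope classical_set_scope.
Local Open Scope ring_scope.

Lemma near_ptE (R : realType) (eps : R) (u v : R * R) : near_pt eps u v = (`|u - v| < eps).
Proof. by rewrite /near_pt prod_normE /= gt_max. Qed.

Lemma far_ptE (R : realType) (eps : R) (u v : R * R) : far_pt eps u v = (3 * eps <= `|u - v|).
Proof. by rewrite /far_pt prod_normE /= le_max. Qed.

Section Arcs.
Variable R : realType.
Implicit Types f g : R -> R * R.

Let I := [set t : R | 0 <= t <= 1].

Let compactI : compact I.
Proof.
suff -> : I = [set` `[0%R, 1%R : R]%R] by exact: segment_compact.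
by apply/seteqP; split => x; rewrite /I /= in_itv.
Qed.

Lemma arc_uniform f (eps : R) : 0 < eps ->
  {within I, continuous f} ->
  exists N : nat, forall x y, I x -> I y -> `|x - y| <= N.+1%:R^-1 -> `|f x - f y| < eps.
Proof.
move=> e0 /subspace_continuousP cf.
have /compact_near_coveringP := compactI.
move=> /(_ _ \oo (fun (N : nat) x => I x -> forall y, I y ->
    `|x - y| <= N.+1%:R^-1 -> `|f x - f y| < eps)).
case.
  move=> x Ix.
  have /cvgrPdist_lt/(_ (eps / 2)) := cf x Ix.
  rewrite divr_gt0// => /(_ isT).
  rewrite near_withinE => /nbhs_ballP[d /= d0 fd].
  have d20 : 0 < d / 2 by rewrite divr_gt0.
  exists (ball x (d / 2), [set N | N.+1%:R^-1 < d / 2]) => /=.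
    split; first exact: nbhsx_ballx.
    exact: near_infty_natSinv_lt (PosNum d20).
  move=> [z N] /= [zx Nd] Iz y Iy zy.
  have fz : `|f x - f z| < eps / 2.
    by apply: fd => //; apply: le_ball zx; rewrite ler_pdivrMr// ler_peMr ?ltW// ltr1n.
  have fy : `|f x - f y| < eps / 2.
    apply: fd => //; rewrite (splitr d); apply: ball_triangle zx _.
    by rewrite /ball /= (le_lt_trans zy).
  rewrite (splitr eps); apply: le_lt_trans (ltrD fz fy).
  by rewrite -(distrC (f z)); exact: ler_distD.
move=> N _ H; exists N => x y Ix Iy; apply: H => //=.
Qed.

Lemma arcs_far f g : {within I, continuous f} -> {within I, continuous g} ->
  (forall s t, I s -> I t -> f s <> g t) ->
  exists2 d : R, 0 < d & forall s t, I s -> I t -> far_pt d (f s) (g t).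
Proof.
move=> cf cg fg.
have [] := @compact_EVT_min _ R (fun z : R * R => `|f z.1 - g z.2|) (I `*` I).
- by exists (0, 0); rewrite /= /I /= lexx ler01.
- exact: compact_setX.
- move/subspace_continuousP: cf => cf; move/subspace_continuousP: cg => cg.
  apply/subspace_continuousP => -[a b] [/= Ia Ib].
  apply: cvg_norm; apply: cvgB.
    apply: (@cvg_comp _ _ _ fst f _ (within I (nbhs a))); last exact: cf.
    move=> P aP; exists ([set t | I t -> P t], setT); first by split => //; exact: filterT.
    by move=> [x y] /= [xP _] [Ix _]; exact: xP.
  apply: (@cvg_comp _ _ _ snd g _ (within I (nbhs b))); last exact: cg.
  move=> P bP; exists (setT, [set t | I t -> P t]); first by split => //; exact: filterT.
  by move=> [x y] /= [_ yP] [_ Iy]; exact: yP.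
move=> [a b]; rewrite inE /= => -[Ia Ib] fmin.
(* The minimal distance is divided by the factor 3 built into [far_pt]. *)
exists (`|f a - g b| / 3).
  by rewrite divr_gt0// normr_gt0 subr_eq0; apply/eqP/fg.
move=> s t Is It; rewrite far_ptE mulrC divfK //.
by apply: (fmin (s, t)); rewrite inE.
Qed.

Lemma arc_path f (eps : R) : 0 < eps -> {within I, continuous f} ->
  exists s, [/\ path (near_pt eps) (f 0) s, last (f 0) s = f 1 &
    {in s, forall u, exists2 t, I t & u = f t}].
Proof.
move=> e0 cf; have [N HN] := arc_uniform e0 cf.
pose x (i : nat) : R := i%:R / N.+1%:R.
have Ix i : (i <= N.+1)%N -> I (x i).
  by move=> iN; rewrite /I /= /x divr_ge0// ler_pdivrMr// mul1r ler_nat.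
have H k : (k <= N.+1)%N -> exists s, [/\ path (near_pt eps) (f 0) s, last (f 0) s = f (x k) &
    {in s, forall u, exists2 t, I t & u = f t}].
  elim: k => [|k IH] kN; first by exists [::]; split; rewrite // /x mul0r.
  have [s [s1 s2 s3]] := IH (ltnW kN).
  exists (rcons s (f (x k.+1))); rewrite rcons_path last_rcons s1 s2 near_ptE; split => //.
    apply: HN; [exact/Ix/ltnW|exact: Ix|].
    by rewrite /x -mulrBl -natr1 opprD addNKr normrM normrN1 mul1r ger0_norm.
  move=> u; rewrite mem_rcons inE => /orP[/eqP ->|]; last exact: s3.
  by exists (x k.+1) => //; exact: Ix.
have [s [s1 s2 s3]] := H N.+1 (leqnn _).
by exists s; split=> //; rewrite s2 /x divff.
Qed.

End Arcs.

End Sampling.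

Section PlanarNoK5.
Local Open Scope ring_scope.

Lemma far_pt_le (R : realFieldType) (d d' : R) u v : d' <= d -> far_pt d u v -> far_pt d' u v.
Proof.
move=> le_d /orP[] /(le_trans _) H; apply/orP; [left|right]; apply: H;
  by rewrite ler_pM2l.
Qed.

Lemma fin_common_radius (R : realFieldType) (T : finType) (P : T -> R -> Prop) :
  (forall x d d', d' <= d -> P x d -> P x d') ->
  (forall x, exists2 d, 0 < d & P x d) -> exists2 d, 0 < d & forall x, P x d.
Proof.
move=> mono Pd.
suff [d d0 H] : exists2 d, 0 < d & {in enum T, forall x, P x d}.
  by exists d => // x; apply: H; rewrite mem_enum.
elim: (enum T) => [|x s [d d0 Hd]]; first by exists 1.
have [d' d'0 Hd'] := Pd x; exists (Num.min d d'); first by rewrite lt_min d0.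
move=> y; rewrite inE => /orP[/eqP->|/Hd].
  by apply: mono Hd'; rewrite ge_min lexx orbT.
by apply: mono; rewrite ge_min lexx.
Qed.

Lemma set2_eq (T : finType) (x y a b : T) : [set x; y] = [set a; b] -> x != y ->
  (x = a /\ y = b) \/ (x = b /\ y = a).
Proof.
move=> /setP e xy.
have := e x; have := e y; rewrite !inE !eqxx orbT /= => /esym/orP[]/eqP ya /esym/orP[]/eqP xa.
- by move: xy; rewrite ya xa eqxx.
- by right.
- by left.
- by move: xy; rewrite ya xa eqxx.
Qed.

(** One radius [d] serves all pairs of disjoint edges. Arcs are sampled with steps below [d] and
    concatenated along the walks of the model. For four distinct indices the two walks use disjoint
    edges, so their chains are far apart and [no_far_K5] applies. *)
Lemma planar_no_K5 n (E : {set {set 'I_n}}) (S : {set 'I_n}) :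
  planar E -> ~ K5_model (adj E) S.
Proof.
move=> [p [g [pinj [gE gX]]]] [r [B [_ rB dB cB]]].
have [d d0 far] : exists2 d : RR, 0 < d & forall ef : {set 'I_n} * {set 'I_n},
    ef.1 \in E -> ef.2 \in E -> [disjoint ef.1 & ef.2] ->
    forall s t, unit_int s -> unit_int t -> far_pt d (g ef.1 s) (g ef.2 t).
  apply: fin_common_radius.
    by move=> ef d d' dd H e f ef' s t Is It; apply: far_pt_le dd _; exact: H.
  move=> [e f] /=; case: (pselect [/\ e \in E, f \in E & [disjoint e & f]]); last first.
    by move=> H; exists 1 => // eE fE ef; case: H.
  move=> [eE fE ef].
  have [ce _ [x [y [exy xy g0 g1]]] pe] := gE e eE.
  have [cf _ [x' [y' [fxy xy' h0 h1]]] pf] := gE f fE.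
  have [] := arcs_far ce cf; last by move=> d d0 H; exists d.
  have ends (z z' : 'I_n) : z \in e -> z' \in f -> p z <> p z'.
    move=> ze zf /pinj zz; move/disjoint_setI0 : ef => /setP/(_ z).
    by rewrite !inE ze zz zf.
  have oi (s : RR) : unit_int s -> [\/ s = 0, s = 1 | open_unit_int s].
    rewrite /unit_int /open_unit_int /= => /andP[].
    rewrite le_eqVlt => /orP[/eqP <-|s0]; first by constructor 1.
    rewrite le_eqVlt => /orP[/eqP ->|s1]; first by constructor 2.
    by constructor 3; rewrite s0.
  have ef' : e != f.
    apply/eqP => eqef; apply: (ends x x) => //; first by rewrite exy !inE eqxx.
    by rewrite -eqef exy !inE eqxx.
  have [xe ye xf yf] : [/\ x \in e, y \in e, x' \in f & y' \in f].
    by rewrite exy fxy !inE !eqxx !orbT.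
  move=> s t /oi[->|->|os] /oi[->|->|ot]; rewrite ?g0 ?g1 ?h0 ?h1.
  all: try exact: ends.
  all: try exact: pe.
  all: try by apply/nesym; exact: pf.
  exact: gX.
(* Points on the arc of an edge with both ends in [A]. *)
pose onE (A : {set 'I_n}) u := exists e t, [/\ e \in E, e \subset A, unit_int t & u = g e t].
have edge (A : {set 'I_n}) x y : induced_rel A (adj E) x y ->
  exists s, [/\ path (near_pt d) (p x) s, last (p x) s = p y,
    {in s, forall u, onE A u} & onE A (p x)].
  move=> /and3P[xA yA /andP[xy eE]].
  have [ce _ [x' [y' [exy xy' g0 g1]]] _] := gE _ eE.
  have sA : [set x; y] \subset A by rewrite finset.subUset !finset.sub1set xA.
  have [s [s1 s2 s3]] := arc_path d0 ce.
  have I0 : unit_int (0 : RR) by rewrite /unit_int /= lexx ler01.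
  have I1 : unit_int (1 : RR) by rewrite /unit_int /= lexx ler01.
  have [[xx yy]|[xx yy]] := set2_eq exy xy.
    have -> : p x = g [set x; y] 0 by rewrite g0 xx.
    have -> : p y = g [set x; y] 1 by rewrite g1 yy.
    exists s; split => //.
      by move=> u /s3[t It ->]; exists [set x; y], t.
    by exists [set x; y], 0.
  (* The arc runs from [y] to [x], so its chain is reversed. *)
  exists (rev (belast (g [set x; y] 0) s)).
  have -> : p x = last (g [set x; y] 0) s by rewrite s2 g1 xx.
  have -> : p y = g [set x; y] 0 by rewrite g0 yy.
  split.
  - by rewrite rev_path (eq_path (e' := near_pt d)) // => u v; rewrite near_ptC.
  - by case: s {s1 s2 s3} => //= u s; rewrite rev_cons last_rcons.
  - move=> u; rewrite mem_rev => /mem_belast; rewrite inE => /orP[/eqP->|/s3[t It ->]].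
      by exists [set x; y], 0.
    by exists [set x; y], t.
  - by rewrite s2; exists [set x; y], 1.
have walk (ij : 'I_5 * 'I_5) : exists s, ij.1 != ij.2 ->
    [/\ path (near_pt d) (p (r ij.1)) s, last (p (r ij.1)) s = p (r ij.2) &
     {in p (r ij.1) :: s, forall u, onE (B ij.1 :|: B ij.2) u}].
  case: ij => i j /=; have [<-|ij] := eqVneq i j; first by exists [::].
  have rij : r i != r j.
    apply/eqP => rr; have /disjoint_setI0/setP/(_ (r i)) := dB i j ij.
    by rewrite !inE rB rr rB.
  have /connectP[q pq lq] := cB i j ij; rewrite lq in rij *.
  move: (B i :|: B j) (r i) pq rij => A x {lq}; clear -edge.
  (* The start of a walk lies on an edge arc only if the walk is nonempty; [r i != r j] guarantees
     this. *)
  suff H : path (induced_rel A (adj E)) x q -> exists s, [/\ path (near_pt d) (p x) s,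
      last (p x) s = p (last x q), {in s, forall u, onE A u} & q != [::] -> onE A (p x)].
    move=> /H[s [s1 s2 s3 s4]] qx; exists s => _; split => // u.
    rewrite inE => /orP[/eqP->|]; last exact: s3.
    by apply: s4; apply: contraNneq qx => ->.
  elim: q x => [|y q IH] x /=; first by exists [::].
  move=> /andP[/edge [s [s1 s2 s3 s4]] /IH[t [t1 t2 t3 _]]].
  exists (s ++ t); rewrite cat_path last_cat s1 s2 t2; split => //.
  by move=> u; rewrite mem_cat => /orP[/s3|/t3].
have [W WP] := choice walk.
apply: (@no_far_K5 RR d (p \o r) (fun i j => W (i, j))).
- move=> i j /pinj rr; apply/eqP/negPn/negP => /dB/disjoint_setI0/setP/(_ (r i)).
  by rewrite !inE rB rr rB.
- by move=> i j ij; have [] := WP (i, j) ij.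
- move=> i j k l U u v.
  move: U; rewrite /= !inE !negb_or => /and4P[/and3P[ij ik il] /andP[jk jl] kl _].
  have [_ _ /(_ u) H1 /H1] := WP (i, j) ij.
  have [_ _ /(_ v) H2 + /H2] := WP (k, l) kl.
  move=> [e [s [eE eA Is ->]]] [f [t [fE fA It ->]]].
  apply: (far (e, f)) => //=.
  apply: disjointWl eA _; apply: disjointWr fA _.
  by rewrite -setI_eq0 finset.setIUl !finset.setIUr !disjoint_setI0 ?finset.setU0 ?dB.
Qed.

End PlanarNoK5.

(** * Straight-line drawings of the gadgets *)

(* [Eqt i s d k] is the [k]-th vertex of the path on side [d] in slot [s] of
   gadget [i]; [Pole i s] is the second common neighbour of that slot. *)
Inductive label := Free | Hub of nat | Pole of nat & bool | Eqt of nat & bool & bool & nat.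

(* The points [Free], [Hub], [Pole], [Eqt] and the open edges of the drawing,
   described by explicit disjoint regions of the plane. *)
Inductive side_kind := AtRim | HubSpoke | PoleSpoke | RimEdge.

Inductive cell :=
| CFree of nat | CHub of nat | CPole of nat & bool | CAxis of nat & bool
| CSide of side_kind & nat & bool & bool & nat.

Section Cells.
Local Open Scope ring_scope.
Variable R : realFieldType.
Implicit Types (P : R * R) (s d : bool).

Definition sg s : R := if s then 1 else -1.

(** Local coordinates of one side of a slot: hub (0, 0), pole (0, 2), k-th path vertex (1/(k+1), 1).
    The equations are those of the points and segments with denominators cleared. *)
Definition in_side (m : side_kind) (k : nat) (u y : R) : Prop :=
  match m with
  | AtRim => y = 1 /\ u * k.+1%:R = 1
  | HubSpoke => 0 < y < 1 /\ u * k.+1%:R = y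
  | PoleSpoke => 1 < y < 2 /\ u * k.+1%:R = 2 - y
  | RimEdge => y = 1 /\ u * k.+1%:R < 1 < u * k.+2%:R
  end.

(** Gadget [i] lies within distance 1 of the vertical line at 3i; the signs of [s] and [d] reflect
    the local picture into its four quadrants. Free vertices lie on the negative horizontal axis. *)
Definition in_cell (c : cell) P : Prop :=
  match c with
  | CFree v => P.1 = - 3 * v.+1%:R /\ P.2 = 0
  | CHub i => P.1 = 3 * i%:R /\ P.2 = 0
  | CPole i s => P.1 = 3 * i%:R /\ sg s * P.2 = 2
  | CAxis i s => P.1 = 3 * i%:R /\ 0 < sg s * P.2 < 2
  | CSide m i s d k => in_side m k (sg d * (P.1 - 3 * i%:R)) (sg s * P.2)
  end.

Lemma in_side_bounds m k u y : in_side m k u y -> [/\ 0 < u, u <= 1, 0 < y & y < 2].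
Proof.
have k1 : 1 <= k.+1%:R :> R by rewrite ler1n.
suff : in_side m k u y -> [/\ 0 < u, u * k.+1%:R <= 1, 0 < y & y < 2].
  move=> H /H[u0 uk y0 y2]; split => //; apply: le_trans uk.
  by rewrite ler_peMr // ltW.
have k0 : 0 < k.+1%:R :> R by rewrite ltr0n.
case: m => /= -[h1 h2]; split; try lra.
- by rewrite -(pmulr_lgt0 _ k0); lra.
- by rewrite -(pmulr_lgt0 _ k0); lra.
- by rewrite -(pmulr_lgt0 _ k0); lra.
Qed.

(** The height separates spokes from the rim. The value of u(k+1) then fixes k, a rim edge being
    strictly between consecutive rim points. *)
Lemma in_side_inj m m' k k' u y : in_side m k u y -> in_side m' k' u y -> m = m' /\ k = k'.
Proof.
move=> H; have [u0 _ _ _] := in_side_bounds H; move: H.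
have lekk (a b : nat) : u * a%:R < u * b%:R -> (a < b)%N by rewrite ltr_pM2l // ltr_nat.
have eqkk (a b : nat) : u * a.+1%:R = u * b.+1%:R -> a = b.
  by move=> /(mulfI (lt0r_neq0 u0)) /eqP; rewrite eqr_nat eqSS => /eqP.
have falso : (1 : R) < 0 -> False by rewrite ltr10.
case: m; case: m' => /= -[h1 h2] -[h3 h4]; try by (exfalso; apply: falso; lra).
all: try by (split => //; apply: eqkk; lra).
- have l1 : (k'.+1 < k.+1)%N by apply: lekk; lra.
  have l2 : (k.+1 < k'.+2)%N by apply: lekk; lra.
  lia.
- have l1 : (k.+1 < k'.+1)%N by apply: lekk; lra.
  have l2 : (k'.+1 < k.+2)%N by apply: lekk; lra.
  lia.
- have l1 : (k'.+1 < k.+2)%N by apply: lekk; lra.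
  have l2 : (k.+1 < k'.+2)%N by apply: lekk; lra.
  by split => //; lia.
Qed.

Lemma sg_inj s s' (y : R) : 0 < sg s * y -> 0 < sg s' * y -> s = s'.
Proof. by rewrite /sg; case: s; case: s' => //; rewrite mul1r mulN1r; lra. Qed.

Lemma column_inj (i j : nat) (x : R) : `|x - 3 * i%:R| <= 1 -> `|x - 3 * j%:R| <= 1 -> i = j.
Proof.
rewrite !ler_norml => /andP[h1 h2] /andP[h3 h4].
have H (a b : nat) : 3 * a%:R - 3 * b%:R <= 2 :> R -> (a <= b)%N.
  by move=> ab; rewrite leqNgt; apply/negP; rewrite -(ler_nat R) -natr1; lra.
by apply/eqP; rewrite eqn_leq !H //; lra.
Qed.

Lemma in_cell_column c P : in_cell c P ->
  match c with
  | CFree _ => P.1 <= -3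
  | CHub i | CPole i _ | CAxis i _ | CSide _ i _ _ _ => `|P.1 - 3 * i%:R| <= 1
  end.
Proof.
case: c => [v|i|i s|i s|m i s d k] /= H.
- case: H => -> _; have : 1 <= v.+1%:R :> R by rewrite ler1n.
  lra.
- by case: H => -> _; rewrite subrr normr0 ler01.
- by case: H => -> _; rewrite subrr normr0 ler01.
- by case: H => -> _; rewrite subrr normr0 ler01.
- have [] := in_side_bounds H; rewrite /sg ler_norml; case: (d); lra.
Qed.

(** The column fixes the gadget, signs fix slot and side, and [in_side_inj] does the rest. *)
Lemma in_cell_inj c c' P : in_cell c P -> in_cell c' P -> c = c'.
Proof.
have falso : (1 : R) < 0 -> False by rewrite ltr10.
have far i : P.1 <= -3 -> `|P.1 - 3 * i%:R| <= 1 -> False.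
  by rewrite ler_norml => h1 /andP[h2 _]; apply: falso; have := ler0n R i; lra.
have sg0 (s : bool) : P.2 = 0 -> 0 < sg s * P.2 -> False by move=> ->; rewrite mulr0 ltxx.
have axis0 i (d : bool) : P.1 = 3 * i%:R -> 0 < sg d * (P.1 - 3 * i%:R) -> False.
  by move=> ->; rewrite subrr mulr0 ltxx.
have pos2 (y : R) : y = 2 -> 0 < y by move=> ->.
move=> H H'; have C := in_cell_column H; have C' := in_cell_column H'; move: H H' C C'.
case: c => [v|i|i s|i s|m i s d k]; case: c' => [v'|i'|i' s'|i' s'|m' i' s' d' k'] H H' C C'.
all: try by (exfalso; apply: (far _ C C')).
all: try by (exfalso; apply: (far _ C' C)).
  case: H => h1 _; case: H' => h1' _; congr CFree.
  by apply/eqP; rewrite -eqSS -(eqr_nat R); apply/eqP; lra.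
all: have ii := column_inj C C'; subst i' => {C C'}.
all: move: H H' => /=.
- by [].
- by move=> [_ h] [_ /pos2/sg0]; case.
- by move=> [_ h] [_ /andP[/sg0]]; case.
- by move=> [_ h] /in_side_bounds[_ _ /sg0]; case.
- by move=> [_ /pos2/sg0 h] [_ /h].
- by move=> [_ h] [_ h']; congr CPole; apply: (@sg_inj _ _ P.2); rewrite pos2.
- move=> [_ h] [_ /andP[h1 h2]]; have ss := sg_inj (pos2 _ h) h1.
  by move: h2; rewrite -ss h ltxx.
- by move=> [h _] /in_side_bounds[/(axis0 _ _ h)].
- by move=> [_ /andP[/sg0 h _]] [_ /h].
- move=> [_ /andP[h1 h2]] [_ h]; have ss := sg_inj h1 (pos2 _ h).
  by move: h2; rewrite ss h ltxx.
- by move=> [_ /andP[h _]] [_ /andP[h' _]]; congr CAxis; exact: sg_inj h h'.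
- by move=> [h _] /in_side_bounds[/(axis0 _ _ h)].
- by move=> /in_side_bounds[_ _ /sg0 h _] [_ /h].
- by move=> /in_side_bounds[h _ _ _] [/axis0/(_ h)].
- by move=> /in_side_bounds[h _ _ _] [/axis0/(_ h)].
- move=> H H'; have [h1 _ h2 _] := in_side_bounds H; have [h1' _ h2' _] := in_side_bounds H'.
  have ss := sg_inj h2 h2'; have dd := sg_inj h1 h1'; subst s' d'.
  by have [-> ->] := in_side_inj H H'.
Qed.

End Cells.

(** * Segments between labelled vertices and planarity of layouts *)

Section Drawing.
Local Open Scope ring_scope.

(** The permitted edges, each in one orientation, with the cell containing its open segment. *)
Inductive joins : label -> label -> cell -> Prop :=
| JoinAxis i s : joins (Hub i) (Pole i s) (CAxis i s)
| JoinHub i s d k : joins (Hub i) (Eqt i s d k) (CSide HubSpoke i s d k)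
| JoinPole i s d k : joins (Pole i s) (Eqt i s d k) (CSide PoleSpoke i s d k)
| JoinRim i s d k : joins (Eqt i s d k) (Eqt i s d k.+1) (CSide RimEdge i s d k).

Definition vcell (v : nat) (L : label) : cell :=
  match L with
  | Free => CFree v
  | Hub i => CHub i
  | Pole i s => CPole i s
  | Eqt i s d k => CSide AtRim i s d k
  end.

Definition segment (R : realType) (P Q : R * R) (t : R) : R * R :=
  ((1 - t) * P.1 + t * Q.1, (1 - t) * P.2 + t * Q.2).

Lemma continuous_segment (R : realType) (P Q : R * R) (A : set R) :
  {within A, continuous (segment P Q)}%classic.
Proof.
apply: continuous_subspaceT => t.
have lin (a b : R) : ((fun x : R => (1 - x) * a + x * b) @ t --> (1 - t) * a + t * b)%classic.
  apply: cvgD; apply: cvgM; try exact: cvg_cst; try exact: cvg_id.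
  by apply: cvgB; [exact: cvg_cst|exact: cvg_id].
exact: (cvg_pair (lin P.1 Q.1) (lin P.2 Q.2)).
Qed.

Lemma segment_inj (R : realType) (P Q : R * R) s t :
  P <> Q -> segment P Q s = segment P Q t -> s = t.
Proof.
move=> PQ [h1 h2]; apply/eqP/negPn/negP => st; apply: PQ.
have st0 : t - s != 0 by rewrite subr_eq0 eq_sym.
rewrite [P]surjective_pairing [Q]surjective_pairing; congr pair; apply: (mulfI st0); lra.
Qed.

Section Layout.
Variable R : realType.

Definition pos (v : nat) (L : label) : R * R :=
  match L with
  | Free => (- 3 * v.+1%:R, 0)
  | Hub i => (3 * i%:R, 0)
  | Pole i s => (3 * i%:R, sg R s * 2)
  | Eqt i s d k => (3 * i%:R + sg R d / k.+1%:R, sg R s)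
  end.

Lemma sg_sq (s : bool) : sg R s * sg R s = 1.
Proof. by case: s; rewrite /sg; lra. Qed.

Lemma in_cell_pos v L : in_cell (vcell v L) (pos v L).
Proof.
case: L => [|i|i s|i s d k] //=; split => //; rewrite ?sg_sq //.
  by rewrite mulrA sg_sq mul1r.
by rewrite addrC addKr mulrA sg_sq mul1r mulVf.
Qed.

Lemma joins_segment v w L L' c t : joins L L' c -> 0 < t < 1 ->
  in_cell c (segment (pos v L) (pos w L') t).
Proof.
move=> J /andP[t0 t1].
have sg_div (d : bool) (x : R) : sg R d * (sg R d / x) = x^-1.
  by rewrite mulrA sg_sq mul1r.
have shift (a b : R) : (1 - t) * a + t * (a + b) - a = t * b by ring.
case: J => [i s|i s d k|i s d k|i s d k] /=.
- split; first lra.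
  have -> : sg R s * ((1 - t) * 0 + t * (sg R s * 2)) = t * 2 by case: (s); rewrite /sg; lra.
  lra.
- have -> : sg R s * ((1 - t) * 0 + t * sg R s) = t by case: (s); rewrite /sg; lra.
  split; first lra.
  by rewrite shift mulrCA sg_div divfK.
- have -> : sg R s * ((1 - t) * (sg R s * 2) + t * sg R s) = 2 - t by case: (s); rewrite /sg; lra.
  split; first lra.
  by rewrite shift mulrCA sg_div divfK //; lra.
- have -> : sg R s * ((1 - t) * sg R s + t * sg R s) = 1 by case: (s); rewrite /sg; lra.
  split => //.
  set a := _ / _; set b := _ / k.+2%:R.
  have -> : (1 - t) * (3 * i%:R + a) + t * (3 * i%:R + b) - 3 * i%:R = (1 - t) * a + t * b by ring.
  rewrite mulrDr mulrCA (mulrCA _ t) !sg_div.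
  have e1 : k.+1%:R^-1 * k.+1%:R = 1 :> R by rewrite mulVf.
  have e2 : k.+2%:R^-1 * k.+2%:R = 1 :> R by rewrite mulVf.
  have kk : k.+2%:R = k.+1%:R + 1 :> R by rewrite -natr1.
  have i1 : 0 < k.+1%:R^-1 :> R by rewrite invr_gt0 ltr0n.
  have i2 : 0 < k.+2%:R^-1 :> R by rewrite invr_gt0 ltr0n.
  have e3 : k.+2%:R^-1 * k.+1%:R = 1 - k.+2%:R^-1 :> R.
    by rewrite -[X in X - _]e2 [X in _ * X - _]kk mulrDr mulr1 addrK.
  have e4 : k.+1%:R^-1 * k.+2%:R = 1 + k.+1%:R^-1 :> R by rewrite kk mulrDr e1 mulr1.
  have j1 := mulr_gt0 t0 i2.
  have t1' : 0 < 1 - t by lra.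
  have j2 := mulr_gt0 t1' i1.
  rewrite 2!(mulrDl ((1 - t) * _)) -!(mulrA _ _^-1) e1 e2 e3 e4.
  apply/andP; split.
    have -> : (1 - t) * 1 + t * (1 - k.+2%:R^-1) = 1 - t / k.+2%:R by ring.
    by rewrite ltrBlDr ltrDl.
  have -> : (1 - t) * (1 + k.+1%:R^-1) + t * 1 = 1 + (1 - t) / k.+1%:R by ring.
  by rewrite ltrDl.
Qed.

Lemma joins_inj L L' M M' c : joins L L' c -> joins M M' c -> L = M /\ L' = M'.
Proof.
by move=> J; case: J => *; match goal with H : joins _ _ _ |- _ => inversion H end; subst.
Qed.

Lemma joins_vcell v M L L' c : joins L L' c -> c <> vcell v M.
Proof. by case=> *; case: M. Qed.

Lemma joins_Free L L' c : joins L L' c -> L <> Free /\ L' <> Free.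
Proof. by case. Qed.

Lemma joins_neq L L' c : joins L L' c -> L <> L'.
Proof. by case=> // i s d k [] /n_Sn. Qed.

End Layout.
(** A common inner point of two segments puts both in the same cell; a cell determines its two
    labels, and a label other than [Free] belongs to one vertex, so the edges coincide. *)
Lemma layout_planar n (E : {set {set 'I_n}}) (lab : 'I_n -> label) :
  (forall v w, lab v = lab w -> lab v = Free \/ v = w) ->
  (forall e, e \in E -> exists x y c, e = [set x; y] /\ joins (lab x) (lab y) c) ->
  planar E.
Proof.
move=> lab_inj Ejoin.
pose p (v : 'I_n) : RR * RR := pos RR v (lab v).
have pc (v : 'I_n) : in_cell (vcell v (lab v)) (p v) by exact: in_cell_pos.
have pinj : injective p.
  move=> v w pvw; have := pc v; rewrite pvw => /in_cell_inj/(_ (pc w)).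
  case lv : (lab v) => [|i|i s|i s d k]; case lw : (lab w) => [|j|j s'|j s' d' k'] //= [].
  - by move=> /val_inj.
  - by move=> ij; have [] := lab_inj v w; rewrite ?lv ?lw ?ij.
  - by move=> ij ss; have [] := lab_inj v w; rewrite ?lv ?lw ?ij ?ss.
  - by move=> ij ss dd kk; have [] := lab_inj v w; rewrite ?lv ?lw ?ij ?ss ?dd ?kk.
have /choice[g gP] : forall e : {set 'I_n}, exists ge : RR -> RR * RR, e \in E ->
    exists x y c, [/\ e = [set x; y], joins (lab x) (lab y) c & ge = segment (p x) (p y)].
  move=> e; have [eE|_] := boolP (e \in E); last by exists (fun=> (0, 0)).
  have [x [y [c [exy J]]]] := Ejoin e eE.
  by exists (segment (p x) (p y)) => _; exists x, y, c.
have J_neq x y c : joins (lab x) (lab y) c -> x != y.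
  by move=> J; apply/eqP => xy; rewrite xy in J; case: (joins_neq J).
exists p, g; split => //; split.
- move=> e eE; have [x [y [c [exy J ->]]]] := gP e eE.
  have xy := J_neq x y c J; have pxy : p x <> p y by move=> /pinj /eqP; exact/negP.
  split.
  + exact: continuous_segment.
  + by move=> s t _ _; exact: segment_inj.
  + exists x, y; rewrite /segment subrr subr0 !mul0r !mul1r !addr0 !add0r.
    by rewrite -!surjective_pairing.
  + move=> t v t01 pv; have := joins_segment x y J t01; rewrite pv => H.
    exact: (joins_vcell (v := v) (M := lab v) J (in_cell_inj H (pc v))).
- move=> e f eE fE ef s t s01 t01.
  have [x [y [c [exy J ->]]]] := gP e eE; have [x' [y' [c' [fxy J' ->]]]] := gP f fE.
  move=> gst; have H := joins_segment x y J s01; have H' := joins_segment x' y' J' t01.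
  have cc : c = c' by move: H; rewrite gst => H; exact: in_cell_inj H H'.
  rewrite -cc in J'; have [lx ly] := joins_inj J J'; have [fx fy] := joins_Free J.
  have xx : x = x' by case: (lab_inj _ _ lx).
  have yy : y = y' by case: (lab_inj _ _ ly).
  by rewrite exy fxy xx yy eqxx in ef.
Qed.

End Drawing.

(** * The game *)

Lemma trianglesE n (E : {set {set 'I_n}}) : triangles E = #|[set t | is_triangle E t]|.
Proof. by []. Qed.

Lemma triangles_planar n (E : {set {set 'I_n}}) : planar E -> triangles E <= 3 * n.
Proof.
move=> pE; have := @card_triangles_bound _ E (planar_no_K5 pE).
by rewrite card_ord.
Qed.

Lemma is_triangle_sub (V : finType) (E E' : {set {set V}}) t :
  E \subset E' -> is_triangle E t -> is_triangle E' t.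
Proof.
move=> sE /andP[t3 /forall_inP tE]; rewrite /is_triangle t3 /=.
apply/forall_inP => x xt; apply/forall_inP => y yt; apply/implyP => xy.
by apply: (fintype.subsetP sE); have /forall_inP/(_ y yt) := tE x xt; rewrite xy.
Qed.

Lemma triangles_sub n (E E' : {set {set 'I_n}}) : E \subset E' -> triangles E <= triangles E'.
Proof.
move=> sE; apply: subset_leq_card; apply/fintype.subsetP => t; rewrite !inE.
exact: is_triangle_sub.
Qed.

Lemma triangles_le_bin n (E : {set {set 'I_n}}) : triangles E <= 'C(n, 3).
Proof.
rewrite -[n in 'C(n, _)]card_ord -card_draws; apply: subset_leq_card.
by apply/fintype.subsetP => t; rewrite !inE => /andP[].
Qed.

Section Game.
Variable n : nat.
Implicit Types (C B : {set {set 'I_n}}).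

Definition unclaimed C B := [set e in Kn_edges n | (e \notin C) && (e \notin B)].

Lemma leq_bigminn (I : finType) (P : pred I) (F : I -> nat) x m :
  m <= x -> (forall i, P i -> m <= F i) -> m <= \big[minn/x]_(i | P i) F i.
Proof. by move=> mx mF; elim/big_ind: _ => // a b ma mb; rewrite leq_min ma. Qed.

Lemma bigminn_leq (I : finType) (P : pred I) (F : I -> nat) x i0 :
  P i0 -> \big[minn/x]_(i | P i) F i <= F i0.
Proof.
move=> Pi0; have := mem_index_enum i0; elim: (index_enum I) => //= i r IH.
rewrite big_cons inE => /orP[/eqP <-|/IH H]; first by rewrite Pi0 geq_minl.
by case: ifP => // _; rewrite (leq_trans (geq_minr _ _)).
Qed.

(** Constructor's edges are never removed, so triangles once made are kept and the analysis may stop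
    when there are enough. *)
Lemma pcb_val_ge k turnC C B : triangles C <= pcb_val k turnC C B.
Proof.
elim: k turnC C B => [|k IH] [] C B //=; case: ifP => [_|/negbT] //.
  rewrite cards_eq0 => /set0Pn[e eM].
  apply: leq_trans (leq_bigmax_cond _ eM); apply: leq_trans (IH _ _ _).
  exact/triangles_sub/finset.subsetUr.
move=> _; apply: leq_bigminn => [|e _]; [exact: triangles_le_bin|exact: IH].
Qed.

Lemma pcb_val_le_planar k turnC C B : planar C -> pcb_val k turnC C B <= 3 * n.
Proof.
elim: k turnC C B => [|k IH] [] C B pC /=; try exact: triangles_planar.
  case: ifP => _; first exact: triangles_planar.
  by apply/bigmax_leqP => e; rewrite inE => /andP[_ /and3P[_ _ /asboolP pe]]; exact: IH.
case: ifP => [_|/negbT]; first exact: triangles_planar.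
rewrite cards_eq0 => /set0Pn[e eU].
by apply: leq_trans (bigminn_leq _ _ eU) _; exact: IH.
Qed.

Lemma pcb_val_le_bin k turnC C B : pcb_val k turnC C B <= 'C(n, 3).
Proof.
elim: k turnC C B => [|k IH] [] C B /=; try exact: triangles_le_bin.
  case: ifP => _; first exact: triangles_le_bin.
  by apply/bigmax_leqP => e _; exact: IH.
case: ifP => [_|/negbT]; first exact: triangles_le_bin.
rewrite cards_eq0 => /set0Pn[e eU].
by apply: leq_trans (bigminn_leq _ _ eU) _; exact: IH.
Qed.

(* Quantifying over all sufficient fuels makes the fuel disappear below. *)
Definition wins N turnC C B :=
  forall k, #|unclaimed C B| <= k -> N <= pcb_val k turnC C B.

Lemma wins_triangles N turnC C B : N <= triangles C -> wins N turnC C B.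
Proof. by move=> NC k _; apply: leq_trans (pcb_val_ge _ _ _ _). Qed.

Lemma unclaimedC C B e : e \in unclaimed C B -> unclaimed (e |: C) B = unclaimed C B :\ e.
Proof.
move=> eU; apply/setP => f; rewrite !inE negb_or.
by case: (f == e); rewrite ?andbF //= andbC.
Qed.

Lemma unclaimedB C B e : e \in unclaimed C B -> unclaimed C (e |: B) = unclaimed C B :\ e.
Proof.
move=> eU; apply/setP => f; rewrite !inE negb_or.
by case: (f == e); rewrite ?andbF.
Qed.

Lemma wins_constructor N C B e : e \in unclaimed C B -> planar (e |: C) ->
  wins N false (e |: C) B -> wins N true C B.
Proof.
move=> eU pe W [|k] Uk.
  by move: Uk; rewrite leqn0 cards_eq0 => /eqP U0; rewrite U0 inE in eU.
have eM : e \in [set e in Kn_edges n | [&& e \notin C, e \notin B & `[< planar (e |: C) >]]].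
  move: eU; rewrite !inE => /andP[eK /andP[eC eB]]; rewrite eK eC eB /=.
  exact/asboolP.
rewrite /=; case: ifP => [|_]; first by rewrite cards_eq0 => /eqP M0; rewrite M0 inE in eM.
apply: leq_trans (leq_bigmax_cond _ eM); apply: W.
by move: Uk; rewrite unclaimedC // (cardsD1 e (unclaimed C B)) eU.
Qed.

Lemma wins_blocker N C B :
  (forall e, e \in unclaimed C B -> wins N true C (e |: B)) ->
  (unclaimed C B = finset.set0 -> N <= triangles C) -> wins N false C B.
Proof.
move=> WU W0 k Uk; have [U0|[e0 e0U]] := set_0Vmem (unclaimed C B).
  exact: leq_trans (W0 U0) (pcb_val_ge _ _ _ _).
case: k Uk => [|k] Uk; first by move: Uk; rewrite leqn0 cards_eq0 => /eqP U0; rewrite U0 inE in e0U.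
rewrite /= -/(unclaimed C B); case: ifP => [|_].
  by rewrite cards_eq0 => /eqP U0; rewrite U0 inE in e0U.
have W e : e \in unclaimed C B -> N <= pcb_val k true C (e |: B).
  move=> eU; apply: WU => //; move: Uk.
  by rewrite unclaimedB // (cardsD1 e (unclaimed C B)) eU.
(* The neutral element of the minimum is harmless: it is at least the value after the move [e0]. *)
apply: leq_bigminn => //; apply: leq_trans (W _ e0U) _; exact: pcb_val_le_bin.
Qed.

End Game.

(** * Layouts as certificates of planarity *)

Section Layouts.
Variable n : nat.
Implicit Types (C B : {set {set 'I_n}}) (lab : 'I_n -> label) (u v w x y : 'I_n).

Definition is_free (L : label) := if L is Free then true else false.
Definition is_deep (L : label) := if L is Eqt _ _ _ k then 0 < k else false.

(** [C] may be any part of the drawn edges. Free vertices are isolated in [C], so they can be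
    relabelled at will during play. *)
Definition layout C lab :=
  (forall v w, lab v = lab w -> lab v = Free \/ v = w) /\
  (forall e, e \in C -> exists x y c, e = [set x; y] /\ joins (lab x) (lab y) c).

Definition relabel lab v L : 'I_n -> label := fun u => if u == v then L else lab u.

Lemma relabel_eq lab v L : relabel lab v L v = L.
Proof. by rewrite /relabel eqxx. Qed.

Lemma relabel_neq lab v L u : u != v -> relabel lab v L u = lab u.
Proof. by rewrite /relabel => /negPf->. Qed.

Lemma layout_free C lab v : layout C lab -> lab v = Free -> forall u, [set u; v] \notin C.
Proof.
move=> [_ H] fv u; apply/negP => /H[x [y [c [exy /joins_Free[fx fy]]]]].
have : v \in [set x; y] by rewrite -exy !inE eqxx orbT.
by rewrite !inE => /orP[] /eqP vv; subst v.
Qed.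

Lemma layout_relabel C lab v L : layout C lab -> lab v = Free -> (forall u, lab u <> L) ->
  layout C (relabel lab v L).
Proof.
move=> lay fv nL; split.
  move=> u w; rewrite /relabel; have [->|uv] := eqVneq u v; have [->|wv] := eqVneq w v; auto.
  - by move=> Lw; case: (nL w).
  - by move=> Lw; case: (nL u).
  - exact: lay.1.
move=> e eC; have [x [y [c [exy J]]]] := lay.2 e eC.
have [fx fy] := joins_Free J; exists x, y, c; split => //.
by rewrite !relabel_neq //; apply/eqP => xv; subst.
Qed.

Lemma layout_add C lab x y c : layout C lab -> joins (lab x) (lab y) c ->
  layout ([set x; y] |: C) lab.
Proof.
move=> [li lj] J; split => // e; rewrite !inE => /orP[/eqP->|]; last exact: lj.
by exists x, y, c.
Qed.

Lemma layout_is_planar C lab : layout C lab -> planar C.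
Proof. by move=> [li lj]; exact: layout_planar li lj. Qed.

(** The index found is where a new vertex goes: it starts an empty path or follows a vertex already
    on the path. *)
Lemma least_unused lab i s d : exists k, (forall u, lab u <> Eqt i s d k) /\
  (k = 0 \/ exists u, lab u = Eqt i s d k.-1).
Proof.
pose kof L := if L is Eqt _ _ _ k then k else 0.
pose P k := `[< forall u, lab u <> Eqt i s d k >].
have exP : exists k, P k.
  exists (\max_u kof (lab u)).+1; apply/asboolP => u lu.
  have := leq_bigmax (F := fun u => kof (lab u)) u; rewrite /= lu /= ltnn //.
case: (ex_minnP exP) => k /asboolP Pk kmin; exists k; split => //.
case: k Pk kmin => [|k] Pk kmin; [by left|right].
apply: contrapT => H; have := kmin k; rewrite ltnn => /(_ _)/negP; case => //.
by apply/asboolP => u lu; apply: H; exists u.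
Qed.

Lemma is_triangle3 (V : finType) (E : {set {set V}}) (a b c : V) : uniq [:: a; b; c] ->
  [set a; b] \in E -> [set a; c] \in E -> [set b; c] \in E -> is_triangle E [set a; b; c].
Proof.
rewrite /= !inE negb_or andbT => /andP[/andP[ab ac] bc] abE acE bcE.
rewrite /is_triangle -finset.setUA cardsU1 cards2 !inE negb_or ab ac bc /=.
apply/forall_inP => x xt; apply/forall_inP => y yt; apply/implyP.
move: xt yt; rewrite !inE => /or3P[] /eqP-> /or3P[] /eqP->; by rewrite ?eqxx // finset.setUC.
Qed.

Lemma triangles_gain C C' v a b w : C \subset C' -> (forall u, [set u; v] \notin C) ->
  uniq [:: v; a; b; w] -> {subset [:: [set a; b]; [set a; w]; [set b; w]] <= C} ->
  {subset [:: [set a; v]; [set b; v]; [set w; v]] <= C'} ->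
  triangles C + 3 <= triangles C'.
Proof.
move=> sC vC U old new.
have inC (e : {set 'I_n}) : e \in C -> e \in C' by move=> /(fintype.subsetP sC).
have [avC bvC wvC] : [/\ [set v; a] \in C', [set v; b] \in C' & [set v; w] \in C'].
  by split; rewrite finset.setUC; apply: new; rewrite !inE eqxx ?orbT.
have [abC awC bwC] : [/\ [set a; b] \in C', [set a; w] \in C' & [set b; w] \in C'].
  by split; apply/inC/old; rewrite !inE eqxx ?orbT.
have := U; rewrite /= !inE !negb_or andbT => /and3P[/and3P[va vb vw] /andP[ab aw] bw].
rewrite !trianglesE.
set T := [set t | is_triangle C t]; set T' := [set t | _].
pose t1 := [set v; a; b]; pose t2 := [set v; a; w]; pose t3 := [set v; b; w].
have notT x y : v != x -> [set v; x; y] \notin T.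
  move=> vx; rewrite inE; apply/negP => /andP[_ /forall_inP/(_ v)].
  rewrite !inE eqxx => /(_ isT)/forall_inP/(_ x); rewrite !inE eqxx orbT => /(_ isT).
  by rewrite vx /= finset.setUC (negPf (vC x)).
have sub : t1 |: (t2 |: (t3 |: T)) \subset T'.
  rewrite !finset.subUset !finset.sub1set !inE; apply/and4P; split.
  - by apply: is_triangle3 => //; rewrite /= !inE !negb_or va vb ab.
  - by apply: is_triangle3 => //; rewrite /= !inE !negb_or va vw aw.
  - by apply: is_triangle3 => //; rewrite /= !inE !negb_or vb vw bw.
  - by apply/fintype.subsetP => t; rewrite !inE; exact: is_triangle_sub.
apply: leq_trans (subset_leq_card sub).
have t12 : t1 != t2.
  apply/negP => /eqP/finset.setP/(_ b).
  by rewrite !inE eqxx orbT (eq_sym b v) (eq_sym b a) (negPf vb) (negPf ab) (negPf bw).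
have t13 : t1 != t3.
  apply/negP => /eqP/finset.setP/(_ a).
  by rewrite !inE eqxx orbT (eq_sym a v) (negPf va) (negPf ab) (negPf aw).
have t23 : t2 != t3.
  apply/negP => /eqP/finset.setP/(_ a).
  by rewrite !inE eqxx orbT (eq_sym a v) (negPf va) (negPf ab) (negPf aw).
by rewrite !cardsU1 !in_setU1 !negb_or t12 t13 t23 !notT //= !add1n addn3.
Qed.

End Layouts.

(** * The invariant of Constructor's strategy *)

Section Strategy.
Variables (n M : nat).
Implicit Types (C B : {set {set 'I_n}}) (lab : 'I_n -> label) (u v w x y a b : 'I_n).

Definition column (L : label) :=
  match L with
  | Free => None
  | Hub i | Pole i _ | Eqt i _ _ _ => Some i
  end.

(* Each deep vertex was inserted with three new triangles and each labelled
   vertex cost at most three edges. *)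
Record good C lab : Prop := Good {
  good_layout : layout C lab;
  good_hub : forall i, i < M -> exists a, lab a = Hub i;
  good_column : forall u i, column (lab u) = Some i -> i < M;
  good_pole : forall a b i s, lab a = Hub i -> lab b = Pole i s -> [set a; b] \in C;
  good_eqt : forall w i s d k, lab w = Eqt i s d k -> exists a b,
    [/\ lab a = Hub i, lab b = Pole i s, [set a; w] \in C & [set b; w] \in C];
  good_triangles : 3 * #|[set u | is_deep (lab u)]| <= triangles C;
  good_card : #|C| <= 3 * #|[set u | ~~ is_free (lab u)]| }.

Definition free_set lab := [set u | is_free (lab u)].

Definition blocked B v := [set u | [set u; v] \in B].

Lemma set2_injl u w v : [set u; v] = [set w; v] -> u = w.
Proof.
move=> /finset.setP e; have := e u; have := e w; rewrite !inE !eqxx /=.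
by case: eqVneq => //= _; case: (eqVneq u w) => //= uw /eqP -> /esym/eqP ->.
Qed.

Lemma sum_blocked B : B \subset Kn_edges n -> \sum_v #|blocked B v| <= 2 * #|B|.
Proof.
move=> BK; apply: (@leq_trans (\sum_v #|[set e in B | v \in e]|)).
  apply: leq_sum => v _; rewrite -(card_in_imset (f := fun u => [set u; v])); last first.
    by move=> u w _ _; exact: set2_injl.
  apply: subset_leq_card; apply/fintype.subsetP => e /imsetP[u].
  by rewrite !inE => uB ->; rewrite uB !inE eqxx orbT.
rewrite (eq_bigr (fun v => \sum_(e in B | v \in e) 1)); last first.
  by move=> v _; rewrite -sum1_card; apply: eq_bigl => e; rewrite inE.
rewrite (exchange_big_dep (mem B)) //=; last by move=> v e _ /andP[].
rewrite mulnC -sum_nat_const; apply: leq_sum => e eB.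
rewrite (eq_bigl (mem e)); last by move=> v; rewrite eB.
by rewrite sum1_card; have := fintype.subsetP BK e eB; rewrite inE => /eqP->.
Qed.

(** A gadget has seven labels that are not deep: the hub, two poles and four first path vertices.
    They are numbered consecutively. *)
Definition shallow_code (L : label) :=
  match L with
  | Free => 0
  | Hub i => 7 * i
  | Pole i s => 7 * i + 1 + s
  | Eqt i s d _ => 7 * i + 3 + (2 * s + d)
  end.

Lemma card_shallow C lab : good C lab ->
  #|[set u | ~~ is_free (lab u) && ~~ is_deep (lab u)]| <= 7 * M.
Proof.
move=> g; set S := [set u | _].
have Slab u : u \in S -> ~~ is_free (lab u) && ~~ is_deep (lab u) by rewrite inE.
rewrite -[7 * M](size_iota 0) cardE -(size_map (fun u => shallow_code (lab u))).
apply: uniq_leq_size.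
  rewrite map_inj_in_uniq ?enum_uniq // => u w; rewrite !mem_enum => /Slab us /Slab ws cuw.
  have [|fu|] := (good_layout g).1 u w; last by [].
  { move: us ws cuw; case: (lab u) => [|i|i s|i s d [|k]] //;
    case: (lab w) => [|j|j s'|j s' d' [|k']] //= _ _.
    all: try case: s; try case: d; try case: s'; try case: d'; move=> /= cc; try by (exfalso; lia).
    all: by have -> : i = j by lia. }
  by move: us; rewrite fu.
move=> c /mapP[u]; rewrite mem_enum => /Slab us ->; rewrite mem_iota add0n /=.
have := @good_column _ _ g u.
by move: us; case: (lab u) => [|i|i s|i s d k] //= _ /(_ i erefl); try case: s; try case: d; lia.
Qed.

(** Each free vertex meets at least M edges of Blocker, who has at most 3n edges in all, so at most
    F vertices are free. At most 7M others are shallow; the rest are deep and account for three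
    triangles each. *)
Lemma good_score C B lab F : good C lab -> B \subset Kn_edges n -> #|B| <= #|C| ->
  6 * n < M * F.+1 -> (forall v, lab v = Free -> M <= #|blocked B v|) ->
  3 * (n - 7 * M - F) <= triangles C.
Proof.
move=> g BK BC nMF allb; apply: leq_trans (good_triangles g); rewrite leq_mul2l /=.
have cfree : #|free_set lab| <= F.
  have nf : #|[set u | ~~ is_free (lab u)]| <= n.
    by apply: leq_trans (max_card _) _; rewrite card_ord.
  have : M * #|free_set lab| <= 2 * #|B|.
    apply: leq_trans (sum_blocked BK); rewrite (bigID (mem (free_set lab))) /=.
    apply: leq_trans (leq_addr _ _); rewrite mulnC -sum_nat_const; apply: leq_sum => v.
    by rewrite inE => fv; apply: allb; case: (lab v) fv.
  have := good_card g; move: nMF nf; rewrite -ltnS => nMF nf h1 h2.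
  have : M * #|free_set lab| < M * F.+1 by lia.
  by rewrite ltn_mul2l => /andP[].
have := card_shallow g; set S := [set u | _]; set D := [set u | is_deep _] => cS.
have : #|[set: 'I_n]%SET| <= #|free_set lab| + (#|S| + #|D|).
  apply: leq_trans (_ : #|free_set lab :|: (S :|: D)| <= _).
    apply: subset_leq_card; apply/fintype.subsetP => u _; rewrite !inE.
    by case: (is_free _) => //=; case: (is_deep _).
  by apply: leq_trans (leq_card_setU _ _) _; rewrite leq_add2l leq_card_setU.
rewrite cardsT card_ord => h; rewrite -subnDA leq_subLR; apply: leq_trans h _.
by rewrite addnA leq_add2r addnC leq_add.
Qed.

(** Pigeonhole: fewer than M blocked vertices meet fewer than M gadgets. The default [M] for free
    vertices lies outside the range of gadgets. *)
Lemma untouched_column B lab v : #|blocked B v| < M ->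
  exists2 i, i < M & forall u, column (lab u) = Some i -> [set u; v] \notin B.
Proof.
move=> bM; pose s := [seq odflt M (column (lab u)) | u <- enum (blocked B v)].
have [/allP sub|] := boolP (all (mem s) (iota 0 M)).
  have := uniq_leq_size (iota_uniq 0 M) sub.
  by rewrite size_iota size_map -cardE leqNgt bM.
move=> /allPn[i]; rewrite mem_iota add0n => iM /= nis; exists i => // u cu.
apply: contra nis => uB; apply/mapP; exists u; first by rewrite mem_enum inE.
by rewrite cu.
Qed.

(** Common bookkeeping for the three ways to insert [v]: as a pole, as the first vertex of a path,
    or as a deep vertex. *)
Lemma good_insert C C' lab v L i : good C lab -> lab v = Free ->
  (forall u, lab u <> L) -> column L = Some i -> i < M ->
  C \subset C' -> #|C'| <= #|C| + 3 -> layout C' (relabel lab v L) ->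
  (forall s, L = Pole i s -> forall a, lab a = Hub i -> [set a; v] \in C') ->
  (forall s d k, L = Eqt i s d k -> exists a b,
    [/\ lab a = Hub i, lab b = Pole i s, [set a; v] \in C' & [set b; v] \in C']) ->
  (is_deep L -> triangles C + 3 <= triangles C') ->
  good C' (relabel lab v L) /\ #|free_set (relabel lab v L)| < #|free_set lab|.
Proof.
move=> g fv nL cL iM sC cC lay' hP hE hT.
have LF : ~~ is_free L by case: (L) cL.
have inC (e : {set 'I_n}) : e \in C -> e \in C' by apply: fintype.subsetP.
have old u K : lab u = K -> K <> Free -> relabel lab v L u = K.
  by move=> lu KF; rewrite relabel_neq //; apply: contra_notN KF => /eqP uv; rewrite -lu uv.
have LH : forall a, relabel lab v L a = L -> a = v.
  by move=> a; rewrite /relabel; case: eqVneq => // _ /nL.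
have nhub j : L <> Hub j.
  move=> Lj; move: cL; rewrite Lj => -[ji]; have [a ha] := good_hub g iM.
  by apply: (nL a); rewrite Lj ji.
have old' u K : relabel lab v L u = K -> K <> L -> lab u = K.
  by rewrite /relabel; case: eqVneq => // _ <-.
split; first split => //.
- by move=> j /(good_hub g)[a ha]; exists a; apply: old.
- move=> u j; rewrite /relabel; case: eqVneq => [_|_]; last exact: (good_column g).
  by rewrite cL => -[<-].
- move=> a b j s ra rb.
  have ha : lab a = Hub j by apply: old' => //; exact/nesym/nhub.
  move: rb; rewrite /relabel; case: eqVneq => [-> Lj|_ hb]; last first.
    by apply: inC; exact: (good_pole g) ha hb.
  have ji : j = i by move: cL; rewrite Lj => -[].
  by apply: (hP s); rewrite ?Lj ?ha ?ji.
- move=> w j s d k; rewrite /relabel; case: eqVneq => [-> Lj|_ hw].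
    have ji : j = i by move: cL; rewrite Lj => -[].
    have [|a [b [ha hb h1 h2]]] := hE s d k; first by rewrite Lj ji.
    by exists a, b; split => //; apply: old; rewrite ?ha ?hb ?ji.
  have [a [b [ha hb h1 h2]]] := good_eqt g hw.
  by exists a, b; split; [exact: old ha _|exact: old hb _|exact: inC|exact: inC].
- have [dL|dL] := boolP (is_deep L).
    apply: leq_trans (hT dL); apply: leq_trans (leq_add (good_triangles g) (leqnn _)).
    rewrite -mulnSr leq_mul2l /=.
    apply: leq_trans (_ : #|v |: [set u | is_deep (lab u)]| <= _).
      by apply: subset_leq_card; apply/fintype.subsetP => u; rewrite !inE /relabel; case: eqVneq.
    by apply: leq_trans (leq_card_setU _ _) _; rewrite cards1.
  apply: leq_trans (leq_trans (good_triangles g) (triangles_sub sC)).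
  rewrite leq_mul2l /=; apply: subset_leq_card; apply/fintype.subsetP => u.
  by rewrite !inE /relabel; case: eqVneq => // _; rewrite (negPf dL).
- apply: leq_trans cC _; apply: leq_trans (leq_add (good_card g) (leqnn _)) _.
  rewrite -mulnSr leq_mul2l /=.
  apply: leq_trans (_ : #|v |: [set u | ~~ is_free (lab u)]| <= _).
    by rewrite cardsU1 inE fv.
  apply: subset_leq_card; apply/fintype.subsetP => u; rewrite !inE /relabel.
  by case: eqVneq.
- apply: proper_card; apply/properP; split.
    by apply/fintype.subsetP => u; rewrite !inE /relabel; case: eqVneq => // _; rewrite (negPf LF).
  by exists v; rewrite !inE ?relabel_eq ?fv.
Qed.

End Strategy.

(** * Playing one insertion against Blocker *)

Section Winning.
Variables (n M F : nat).
Hypotheses (Mn : M < n) (nMF : 6 * n < M * F.+1).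
Implicit Types (C B : {set {set 'I_n}}) (lab : 'I_n -> label) (u v w x y a b : 'I_n).

Let N := 3 * (n - 7 * M - F).

Lemma unclaimed_edge C B u v : u != v -> [set u; v] \notin C -> [set u; v] \notin B ->
  [set u; v] \in unclaimed C B.
Proof. by move=> uv uC uB; rewrite !inE cards2 uv uC uB. Qed.

Lemma unclaimed_Kn C B e : e \in unclaimed C B -> B \subset Kn_edges n -> e |: B \subset Kn_edges n.
Proof. by rewrite inE => /andP[eK _] BK; rewrite finset.subUset finset.sub1set eK. Qed.

(** When all edges are claimed, the n - 1 edges at a free vertex are all Blocker's, and n - 1 is at
    least M. *)
Lemma exhausted_wins C B lab : good M C lab -> B \subset Kn_edges n -> #|B| <= #|C| ->
  unclaimed C B = finset.set0 -> N <= triangles C.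
Proof.
move=> g BK BC U0; apply: good_score (g) BK BC nMF _ => v fv.
have sub : [set~ v] \subset blocked B v.
  apply/fintype.subsetP => u; rewrite !inE => uv; apply: contraT => uB.
  have := unclaimed_edge uv (layout_free (good_layout g) fv u) uB.
  by rewrite U0 inE.
by apply: leq_trans (subset_leq_card sub); rewrite cardsC1 card_ord; lia.
Qed.

(** Induction on the number of free vertices. One insertion takes up to three moves and restores the
    invariant; if every free vertex is heavily blocked, [good_score] already gives the score. *)
Lemma strategy_wins m C B lab : good M C lab -> B \subset Kn_edges n -> #|B| <= #|C| ->
  #|free_set lab| <= m -> wins N true C B.
Proof.
elim: m C B lab => [|m IH] C B lab g BK BC fm.
  apply/wins_triangles/(good_score g BK BC nMF) => v fv.
  by move: fm; rewrite leqn0 cards_eq0 => /eqP/finset.setP/(_ v); rewrite !inE fv.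
have [[v fv bv]|none] := pselect (exists2 v, lab v = Free & #|blocked B v| < M); last first.
  apply/wins_triangles/(good_score g BK BC nMF) => v fv; rewrite leqNgt.
  by apply/negP => bv; apply: none; exists v.
(* After an insertion Blocker replies once more; the strict inequality leaves room for that edge. *)
have finish C' B' lab' : good M C' lab' -> B' \subset Kn_edges n -> #|B'| < #|C'| ->
    #|free_set lab'| < #|free_set lab| -> wins N false C' B'.
  move=> g' BK' BC' f'; apply: wins_blocker => [e eU|].
    apply: (IH _ _ lab') => //; first exact: unclaimed_Kn eU BK'.
      by apply: leq_trans BC'; rewrite cardsU1; case: (_ \notin _).
    by rewrite -ltnS (leq_trans f').
  by apply: exhausted_wins g' BK' (ltnW BC').
have [i iM colB] := untouched_column lab bv.
have [a ha] := good_hub g iM.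
have lay := good_layout g; have vC := layout_free lay fv.
have neqv u : lab u <> Free -> u != v by move=> uf; apply: contra_not_neq uf => ->.
have av : a != v by apply: neqv; rewrite ha.
have aB : [set a; v] \notin B by apply: colB; rewrite ha.
set C1 := [set a; v] |: C.
have lay1 L c : (forall u, lab u <> L) -> joins (Hub i) L c -> layout C1 (relabel lab v L).
  move=> nL J; apply: (@layout_add _ _ _ a v c); first exact: layout_relabel.
  by rewrite relabel_eq relabel_neq // ha.
have C1card : #|C1| = #|C|.+1 by rewrite cardsU1 vC.
have sC1 : C \subset C1 by exact: finset.subsetUr.
(* If a pole is missing in gadget [i], [v] takes that place with the edge [av] alone. *)
have [[s nos]|poles] := pselect (exists s, forall u, lab u <> Pole i s).
  have l1 := lay1 _ _ nos (JoinAxis i s).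
  apply: (wins_constructor (e := [set a; v])); first exact: unclaimed_edge.
    exact: layout_is_planar l1.
  have [|s' _ a' ha'|//|//|g' f'] := good_insert g fv nos (erefl _) iM sC1 _ l1.
  + by rewrite C1card addn3 ltnW.
  + have -> : a' = a by case: (lay.1 a' a); rewrite ?ha' ?ha.
    by rewrite !inE eqxx.
  + by apply: finish g' BK _ f'; rewrite C1card.
have pole s : exists b, lab b = Pole i s.
  by apply: contrapT => nb; apply: poles; exists s => u lu; apply: nb; exists u.
have [b0 hb0] := pole false.
have blk u : column (lab u) = Some i -> [set u; v] \notin B := colB u.
have nC1 u : u != v -> u != a -> [set u; v] \notin C1.
  by move=> uv ua; rewrite !inE negb_or vC andbT; apply: contra_neq ua => /set2_injl.
(* This slot and side only certify that [av] keeps the graph planar; the real slot is chosen after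
   Blocker's reply. *)
have [k0 [nk0 _]] := least_unused lab i true true.
apply: (wins_constructor (e := [set a; v])); first exact: unclaimed_edge.
  exact: layout_is_planar (lay1 _ _ nk0 (JoinHub _ _ _ _)).
apply: wins_blocker => [e1 e1U|U0]; last first.
  have : [set b0; v] \in unclaimed C1 B.
    apply: unclaimed_edge; [by apply: neqv; rewrite hb0| |by apply: blk; rewrite hb0].
    apply: nC1; first by apply: neqv; rewrite hb0.
    by apply/eqP => ba; move: hb0; rewrite ba ha.
  by rewrite U0 inE.
set B1 := e1 |: B; have BK1 : B1 \subset Kn_edges n by exact: unclaimed_Kn e1U BK.
have B1card : #|B1| <= #|B|.+1 by rewrite cardsU1; case: (_ \notin _).
pose in_slot s L := match L with Pole j s' | Eqt j s' _ _ => (j == i) && (s' == s) | _ => false end.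
(* The reply [e1] joins [v] to at most one vertex, hence spoils at most one of the two slots. *)
have [s safe] : exists s, forall u, in_slot s (lab u) -> [set u; v] != e1.
  have [H|H] := pselect (forall u, in_slot true (lab u) -> [set u; v] != e1); first by exists true.
  exists false => u hu; apply/eqP => ue; apply: H => w hw; apply/eqP => we.
  have uw : u = w by apply: (@set2_injl _ u w v); rewrite ue we.
  by move: hu hw; rewrite uw; case: (lab w) => //= [j|j] s' => [|_ _] /andP[_ /eqP->] /andP[].
have blk1 u : in_slot s (lab u) -> [set u; v] \notin B1.
  move=> hu; rewrite in_setU1 negb_or safe //= blk //.
  by move: hu; case: (lab u) => //= [j s'|j s' d k] /andP[/eqP->].
have [b hb] := pole s.
have bv' : b != v by apply: neqv; rewrite hb.
have ba : b != a by apply/eqP => ba; move: hb; rewrite ba ha.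
have bB1 : [set b; v] \notin B1 by apply: blk1; rewrite hb /= !eqxx.
set C2 := [set b; v] |: C1.
have lay2 d k : (forall u, lab u <> Eqt i s d k) -> layout C2 (relabel lab v (Eqt i s d k)).
  move=> nL; apply: (@layout_add _ _ _ b v (CSide PoleSpoke i s d k)).
    exact: lay1 _ _ nL (JoinHub _ _ _ _).
  by rewrite relabel_eq relabel_neq // hb; exact: JoinPole.
have C2card : #|C2| = #|C|.+2 by rewrite cardsU1 nC1 // C1card.
have sC2 : C \subset C2 by apply: fintype.subset_trans sC1 (finset.subsetUr _ _).
have e2U : [set b; v] \in unclaimed C1 B1 by apply: unclaimed_edge => //; exact: nC1.
have [k1 [nk1 _]] := least_unused lab i s true.
apply: (wins_constructor e2U); first exact: layout_is_planar (lay2 _ _ nk1).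
(* If a path of the slot is empty, [v] starts it and two edges suffice. *)
have [[d nd]|ends] := pselect (exists d, forall u, lab u <> Eqt i s d 0).
  have [|//|s' d' k' [<- _ _]|//|g' f'] := good_insert g fv nd (erefl _) iM sC2 _ (lay2 _ _ nd).
  + by rewrite C2card addn3.
  + by exists a, b; rewrite !inE !eqxx ?orbT.
  + by apply: finish g' BK1 _ f'; rewrite C2card; lia.
have tip d : exists k w, (forall u, lab u <> Eqt i s d k.+1) /\ lab w = Eqt i s d k.
  have [[|k] [nk Hk]] := least_unused lab i s d; first by case: ends; exists d.
  by case: Hk => // -[w hw]; exists k, w.
have lab_uniq u w L : lab u = L -> lab w = L -> L <> Free -> u = w.
  by move=> hu hw LF; case: (lay.1 u w); rewrite ?hu ?hw.
have tipU B' d k w : lab w = Eqt i s d k -> [set w; v] \notin B' -> [set w; v] \in unclaimed C2 B'.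
  move=> hw wB; apply: unclaimed_edge => //; first by apply: neqv; rewrite hw.
  rewrite in_setU1 negb_or nC1 ?andbT.
  - apply/eqP => /set2_injl wb; by move: hb; rewrite -wb hw.
  - by apply: neqv; rewrite hw.
  - by apply/eqP => wa; move: ha; rewrite -wa hw.
have [kt [wt [nkt hwt]]] := tip true; have [kf [wf [nkf hwf]]] := tip false.
apply: wins_blocker => [e2 e2U'|U0]; last first.
  have : [set wt; v] \in unclaimed C2 B1.
    by apply: (tipU _ _ _ _ hwt); apply: blk1; rewrite hwt /= !eqxx.
  by rewrite U0 inE.
set B2 := e2 |: B1; have BK2 : B2 \subset Kn_edges n by exact: unclaimed_Kn e2U' BK1.
have B2card : #|B2| <= #|B|.+2.
  by rewrite cardsU1; apply: leq_trans (leq_add (leq_b1 _) B1card) _.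
(* The two path ends are distinct, so [e2] cannot block both. *)
have [d [k [w [nk hw we2]]]] : exists d k w,
    [/\ forall u, lab u <> Eqt i s d k.+1, lab w = Eqt i s d k & [set w; v] != e2].
  have [et|nt] := eqVneq [set wt; v] e2; last by exists true, kt, wt.
  exists false, kf, wf; split => //; rewrite -et; apply/eqP => /set2_injl wtf.
  by move: hwf; rewrite wtf hwt.
have wB2 : [set w; v] \notin B2.
  by rewrite in_setU1 negb_or we2 /=; apply: blk1; rewrite hw /= !eqxx.
have wU := tipU _ _ _ _ hw wB2.
have wv : w != v by apply: neqv; rewrite hw.
set C3 := [set w; v] |: C2.
have lay3 : layout C3 (relabel lab v (Eqt i s d k.+1)).
  apply: (@layout_add _ _ _ w v (CSide RimEdge i s d k)); first exact: lay2.
  by rewrite relabel_eq relabel_neq // hw; exact: JoinRim.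
have C3card : #|C3| = #|C|.+3.
  by rewrite cardsU1 C2card; move: wU; rewrite inE => /andP[_ /andP[-> _]].
have sC3 : C \subset C3 by apply: fintype.subset_trans sC2 (finset.subsetUr _ _).
apply: (wins_constructor wU); first exact: layout_is_planar lay3.
have [|//|s' d' k' [<- _ _]|_|g' f'] := good_insert g fv nk (erefl _) iM sC3 _ lay3.
- by rewrite C3card addn3.
- by exists a, b; rewrite !inE !eqxx ?orbT.
- have [a' [b' [ha' hb' aw bw]]] := good_eqt g hw.
  have aa : a' = a by exact: lab_uniq ha' ha _.
  have bb : b' = b by exact: lab_uniq hb' hb _.
  rewrite aa in aw; rewrite bb in bw.
  apply: (triangles_gain (v := v) (a := a) (b := b) (w := w)) => //.
  + rewrite /= !inE !negb_or !(eq_sym v) av bv' wv eq_sym ba /= andbT.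
    by apply/andP; split; apply/eqP => xw; move: hw; rewrite -xw ?ha ?hb.
  + move=> e; rewrite !inE => /or3P[] /eqP-> //; exact: (good_pole g) ha hb.
  + by move=> e; rewrite !inE => /or3P[] /eqP->; rewrite eqxx ?orbT.
- by apply: finish g' BK2 _ f'; rewrite C3card ltnS (leq_trans B2card).
Qed.

End Winning.

Lemma g_PCB_K3_le n : g_PCB_K3 n <= 3 * n.
Proof.
apply: pcb_val_le_planar; apply: (@layout_is_planar _ _ (fun=> Free)).
by split=> [v w|e]; [left|rewrite inE].
Qed.

(** Hubs cost no moves: the first M vertices are merely labelled. *)
Lemma good_start n M : M < n ->
  good M finset.set0 (fun u : 'I_n => if u < M then Hub u else Free).
Proof.
move=> Mn; split.
- split=> [v w|e]; last by rewrite inE.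
  by case: ifP => _; case: ifP => _; try (by left); case => /val_inj; right.
- by move=> i iM; exists (Ordinal (ltn_trans iM Mn)); rewrite /= iM.
- by move=> u i; case: ifP => //= uM [<-].
- by move=> a b i s _; case: ifP.
- by move=> w i s d k; case: ifP.
- rewrite (_ : [set u | _] = finset.set0) ?cards0 //.
  by apply/finset.setP => u; rewrite !inE; case: ifP.
- by rewrite cards0.
Qed.

(** * The quantitative lower bound and the limit *)

Lemma g_PCB_K3_ge n M : 0 < M < n -> 3 * n <= g_PCB_K3 n + 3 * (7 * M + (6 * n) %/ M).
Proof.
case/andP=> M0 Mn.
have nMF : 6 * n < M * ((6 * n) %/ M).+1 by rewrite (mulnC M) ltn_ceil.
have W := strategy_wins Mn nMF (good_start Mn) (finset.sub0set _) (leqnn _) (leqnn _).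
have := W 'C(n, 2); rewrite -/(g_PCB_K3 n) => /(_ _) H.
have : 3 * (n - 7 * M - 6 * n %/ M) <= g_PCB_K3 n.
  apply: H; rewrite -[n in 'C(n, _)]card_ord -card_draws; apply: subset_leq_card.
  by apply/fintype.subsetP => e; rewrite !inE => /andP[].
lia.
Qed.


Local Open Scope classical_set_scope.
Local Open Scope ring_scope.

Lemma ratio_cvg1 (R : realType) (f : nat -> nat) : (forall n, f n <= 3 * n)%N ->
  (forall n M, 0 < M < n -> 3 * n <= f n + 3 * (7 * M + (6 * n) %/ M))%N ->
  (fun n => (f n)%:R / (3 * n)%:R : R) @ \oo --> (1 : R).
Proof.
move=> fle fge; apply/cvgrPdist_le => /= e e0.
(* The relative error is at most 7M/n + 6/M. The choice of [M] makes 6/M at most e/2, and n at least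
   [K] makes 7M/n at most e/2. *)
pose M := (Num.bound (12 / e)).+1; pose K := Num.bound (14 * M%:R / e).
have M12 : 12 <= e * M%:R.
  have : 12 / e < (Num.bound (12 / e))%:R by apply: archi_boundP; rewrite divr_ge0 // ltW.
  rewrite ltr_pdivrMr // mulrC => h.
  have -> : M%:R = (Num.bound (12 / e))%:R + 1 :> R by rewrite natr1.
  by rewrite mulrDr mulr1; apply: ltW (lt_trans h _); rewrite ltrDl.
have K14 : 14 * M%:R <= e * K%:R.
  have : 14 * M%:R / e < K%:R by apply: archi_boundP; rewrite divr_ge0 ?mulr_ge0 // ltW.
  by rewrite ltr_pdivrMr // (mulrC _ e) => /ltW.
near=> n.
have Mn : (M < n)%N by near: n; exact: nbhs_infty_gt.
have Kn : (K <= n)%N by near: n; exact: nbhs_infty_ge.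
have n0 : 0 < n%:R :> R by rewrite ltr0n; apply: leq_ltn_trans Mn.
have n30 : 0 < (3 * n)%:R :> R by rewrite natrM mulr_gt0.
rewrite ger0_norm; last first.
  by rewrite subr_ge0 ler_pdivrMr // mul1r ler_nat fle.
rewrite lerBlDr -lerBlDl ler_pdivlMr //.
set q := (6 * n %/ M)%N.
have qM : q%:R * M%:R <= 6 * n%:R :> R by rewrite -!natrM ler_nat leq_divM.
have : (3 * n)%:R <= (f n + 3 * (7 * M + q))%:R :> R.
  by rewrite ler_nat; apply: fge; rewrite Mn.
rewrite natrD !natrM natrD natrM => gn.
have eK : e * K%:R <= e * n%:R by rewrite ler_pM2l // ler_nat.
have q12 : 12 * q%:R <= e * M%:R * q%:R by rewrite ler_wpM2r.
have eq : e * (q%:R * M%:R) <= e * (6 * n%:R) by rewrite ler_pM2l.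
lra.
Unshelve. all: by end_near.
Qed.

(* g_PCB(n,K_3) = (1 + o(1)) 3n, i.e. g_PCB(n,K_3) / (3n) -> 1 as n -> oo. *)
Theorem theorem1p6 :
  (fun n : nat => ((g_PCB_K3 n)%:R / (3 * n)%:R : Rdefinitions.R)) @ \oo --> (1 : Rdefinitions.R).
Proof. exact: ratio_cvg1 g_PCB_K3_le g_PCB_K3_ge. Qed.
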